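(* Let $m\ge1$ and let $\psi\in L^1(\mathbb{R}^m)$ be a probability density with finite moment of order $1$, i.e. $\psi\ge0$, $\int\psi(\xi)\,d^m\xi=1$ and $\int|\xi|\psi(\xi)\,d^m\xi<\infty$. For $x\in\mathbb{R}^m$ and $\sigma>0$ let $\Psi_{\sigma,x}$ be the state of $C_0(\mathbb{R}^m)$ given by $$\Psi_{\sigma,x}(f)=\frac1{\sigma^m}\int_{\mathbb{R}^m} f(\xi)\,\psi\!\left(\tfrac{\xi-x}{\sigma}\right)d^m\xi .$$ Then for all $x,y\in\mathbb{R}^m$ and $\sigma,\sigma'>0$, $$d_D(\Psi_{\sigma,x},\Psi_{\sigma',y})=\int_{\mathbb{R}^m}|x-y+(\sigma-\sigma')\xi|\,\psi(\xi)\,d^m\xi .$$ In particular, for $\sigma=\sigma'$ the distance does not depend on the shape $\psi$: $d_D(\Psi_{\sigma,x},\Psi_{\sigma,y})=|x-y|$.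
   Context: $d_D$ is the spectral distance on the states of $C_0(\mathbb{R}^m)$ (Euclidean space with its flat metric and spin structure): with $D=-i\sum_{\mu=1}^m\gamma^\mu\partial_\mu$ the Dirac operator acting on square-integrable spinors, where the $\gamma^\mu$ are self-adjoint matrices with $\gamma^\mu\gamma^\nu+\gamma^\nu\gamma^\mu=2\delta^{\mu\nu}\mathbb{I}$, functions acting by pointwise multiplication, and $C_0^\infty(\mathbb{R}^m)$ the complex smooth functions vanishing at infinity, $$d_D(\varphi_1,\varphi_2)=\sup\{|\varphi_1(f)-\varphi_2(f)| : f\in C_0^\infty(\mathbb{R}^m),\ \|[D,f]\|_{\mathrm{op}}\le 1\}.$$ It coincides with the Wasserstein distance of order $1$ between the corresponding probability measures, for the Euclidean cost $|x-y|$. *)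

(* Defs.v *)
From HB Require Import structures.
From mathcomp Require Import all_boot all_order all_algebra.
From mathcomp Require Import all_classical all_reals all_analysis.
From mathcomp.real_closed Require Import complex.

Set Implicit Arguments.
Unset Strict Implicit.
Unset Printing Implicit Defensive.

Import Order.TTheory GRing.Theory Num.Theory.
Import numFieldNormedType.Exports.

Local Open Scope classical_set_scope.
Local Open Scope ring_scope.

(* The Borel sigma-algebra of R^m, generated by the coordinates as for the
   library's measurable n-tuples. *)
Section measurable_rV.
Context {R : realType} (m : nat).

Let coor : 'I_m -> 'rV[R]_m -> R := fun i x => x ord0 i.

Let rV_set0 : g_sigma_preimage coor set0.
Proof. exact: sigma_algebra0. Qed.

Let rV_setC A : g_sigma_preimage coor A -> g_sigma_preimage coor (~` A).
Proof. exact: sigma_algebraC. Qed.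

Let rV_bigcup (F : (set 'rV[R]_m)^nat) :
  (forall i, g_sigma_preimage coor (F i)) ->
  g_sigma_preimage coor (\bigcup_i (F i)).
Proof. exact: sigma_algebra_bigcup. Qed.

HB.instance Definition _ := @isMeasurable.Build default_measure_display
  'rV[R]_m (g_sigma_preimage coor) rV_set0 rV_setC rV_bigcup.

Lemma measurable_coor (i : 'I_m) :
  measurable_fun [set: 'rV[R]_m] (fun x => x ord0 i).
Proof.
move=> _ Y mY; rewrite setTI; apply: sub_sigma_algebra => /=.
rewrite -bigcup_seq/=; exists i => /=; first by rewrite mem_index_enum.
by exists Y => //; rewrite setTI.
Qed.

Lemma measurable_fun_coor d (T : measurableType d) (f : T -> 'rV[R]_m) :
  (forall i, measurable_fun [set: T] (fun t => f t ord0 i)) ->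
  measurable_fun [set: T] f.
Proof.
move=> mf _ A mA; rewrite setTI.
suff : g_sigma_preimage coor `<=` [set B | measurable (f @^-1` B)] by apply.
apply: smallest_sub.
  split => /=.
  - by rewrite preimage_set0; exact: measurable0.
  - by move=> B mB; rewrite setTD preimage_setC; exact: measurableC.
  - by move=> F mF; rewrite preimage_bigcup; exact: bigcupT_measurable.
elim/big_ind : _ => //= [B C sB sC' D [/sB//|/sC'//]|i _ B [C mC <-]].
by rewrite setTI /= -[X in measurable X]setTI; exact: (mf i).
Qed.

End measurable_rV.

(* Lebesgue measure on R^m: the unit mass on the one-point space R^0, then
   the image of the product measure under R x R^m ~ R^(1 + m). *)
Section lebesgue_rV.
Context {R : realType}.

Definition rV_cons m (p : R * 'rV[R]_m) : 'rV[R]_m.+1 :=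
  row_mx (p.1%:M : 'rV[R]_1) p.2.

Lemma rV_cons0 m (p : R * 'rV[R]_m) : rV_cons p ord0 ord0 = p.1.
Proof.
rewrite /rV_cons; have -> : ord0 = lshift m ord0 :> 'I_(1 + m) by exact/val_inj.
by rewrite (@row_mxEl _ 1 1 m) mxE mulr1n.
Qed.

Lemma rV_consS m (p : R * 'rV[R]_m) (i : 'I_m) :
  rV_cons p ord0 (lift ord0 i) = p.2 ord0 i.
Proof.
rewrite /rV_cons; have -> : lift ord0 i = rshift 1 i by exact/val_inj.
by rewrite (@row_mxEr _ 1 1 m).
Qed.

Lemma measurable_rV_cons m : measurable_fun setT (@rV_cons m).
Proof.
apply: measurable_fun_coor => i; have [j ->|->] := unliftP ord0 i.
  under eq_fun do rewrite rV_consS.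
  exact: (measurableT_comp (measurable_coor j) measurable_snd).
under eq_fun do rewrite rV_cons0.
exact: measurable_fst.
Qed.

Section step.
Context m (mu : {sigma_finite_measure set 'rV[R]_m -> \bar R}).

Definition lebesgue_rV_step : set 'rV[R]_m.+1 -> \bar R :=
  pushforward (@lebesgue_measure R \x mu)%E (@rV_cons m).

Let preimage_measurable A :
  measurable A -> measurable (@rV_cons m @^-1` A).
Proof.
by move=> mA; rewrite -[X in measurable X]setTI; exact: measurable_rV_cons.
Qed.

Let step0 : (lebesgue_rV_step set0 = 0)%E.
Proof. by rewrite /lebesgue_rV_step /pushforward preimage_set0 measure0. Qed.

Let step_ge0 A : (0 <= lebesgue_rV_step A)%E.
Proof. by rewrite /lebesgue_rV_step /pushforward measure_ge0. Qed.

Let step_sigma_additive : semi_sigma_additive lebesgue_rV_step.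
Proof.
move=> F mF tF mUF; rewrite /lebesgue_rV_step /pushforward preimage_bigcup.
apply: measure_semi_sigma_additive.
- by move=> n; exact: preimage_measurable.
- apply/trivIsetP => /= i j _ _ ij; rewrite -preimage_setI.
  by move/trivIsetP : tF => /(_ _ _ _ _ ij) ->//; rewrite preimage_set0.
- by rewrite -preimage_bigcup; exact: preimage_measurable.
Qed.

HB.instance Definition _ := isMeasure.Build _ _ _ lebesgue_rV_step
  step0 step_ge0 step_sigma_additive.

Let uncons (x : 'rV[R]_m.+1) : R * 'rV[R]_m :=
  (x ord0 ord0, \row_i x ord0 (lift ord0 i)).

Let consK : cancel (@rV_cons m) uncons.
Proof.
move=> [a v]; congr pair; first exact: rV_cons0.
by apply/rowP => i; rewrite mxE rV_consS.
Qed.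

Let step_sigma_finite : sigma_finite setT lebesgue_rV_step.
Proof.
have /sigma_finiteP[F [TF ndF Foo]] := sigma_finiteT (@lebesgue_measure R).
have /sigma_finiteP[G [TG ndG Goo]] := sigma_finiteT mu.
have muncons : measurable_fun setT uncons.
  apply/measurable_fun_pairP; split => /=; first exact: measurable_coor.
  apply: measurable_fun_coor => i /=; under eq_fun do rewrite mxE.
  exact: measurable_coor.
exists (fun n => uncons @^-1` (F n `*` G n)).
  apply/seteqP; split => // x _; set p := uncons x.
  have [i _ Fi] : (\bigcup_i F i) p.1 by rewrite -TF.
  have [j _ Gj] : (\bigcup_i G i) p.2 by rewrite -TG.
  exists (maxn i j) => //; split.
    by move: Fi; exact/subsetPset/ndF/leq_maxl.
  by move: Gj; exact/subsetPset/ndG/leq_maxr.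
move=> n; have [mF Fnoo] := Foo n; have [mG Gnoo] := Goo n; split.
  by rewrite -[X in measurable X]setTI; apply: muncons => //; exact: measurableX.
rewrite /lebesgue_rV_step /pushforward -comp_preimage.
rewrite (_ : uncons \o _ = id); last by apply/funext => p /=; rewrite consK.
rewrite preimage_id product_measure1E// lte_mul_pinfty//.
by rewrite ge0_fin_numE.
Qed.

HB.instance Definition _ := @Measure_isSigmaFinite.Build _ _ _ lebesgue_rV_step
  step_sigma_finite.

End step.

Fixpoint lebesgue_rV m : {sigma_finite_measure set 'rV[R]_m -> \bar R} :=
  if m is m'.+1 then lebesgue_rV_step (lebesgue_rV m') else \d_(0 : 'rV[R]_0).

Lemma lebesgue_rV_box m (A : 'I_m -> set R) :
  (forall i, measurable (A i)) ->
  lebesgue_rV m [set x | forall i, A i (x ord0 i)] =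
  (\prod_(i < m) lebesgue_measure (A i))%E.
Proof.
elim: m A => [|m IH] A mA.
  rewrite big_ord0 /= diracE mem_set//; by case.
have mbox n (B : 'I_n -> set R) : (forall i, measurable (B i)) ->
    measurable [set x : 'rV[R]_n | forall i, B i (x ord0 i)].
  move=> mB; rewrite [X in measurable X](_ : _ =
    \bigcap_(i in [set: 'I_n]) (fun x : 'rV[R]_n => x ord0 i) @^-1` B i).
    apply: fin_bigcap_measurable => [|i _]; first exact: finite_finset.
    by rewrite -[X in measurable X]setTI; exact: measurable_coor.
  by apply/seteqP; split => x /= xB; [move=> i _|move=> i; exact: xB].
rewrite big_ord_recl -IH// /= /lebesgue_rV_step /pushforward.
rewrite -product_measure1E; first last.
- exact: (@mbox m (fun i => A (lift ord0 i))).
- exact: mA.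
congr (product_measure1 _ _ _); apply/seteqP; split => -[a v] /=.
- move=> H; split => [|i]; first by rewrite -[a]/((a, v).1) -rV_cons0.
  by rewrite -[v]/((a, v).2) -rV_consS.
- move=> [Aa Av] i; have [j ->|->] := unliftP ord0 i.
    by rewrite rV_consS.
  by rewrite rV_cons0.
Qed.

End lebesgue_rV.

Section euclidean.
Context {R : realType} {m : nat}.
Implicit Types (x : 'rV[R]_m) (f : 'rV[R]_m -> R[i]).

(* The library's norm on 'rV[R]_m is the sup norm. *)
Definition enorm x : R := Num.sqrt (\sum_(i < m) x ord0 i ^+ 2).

Definition partial (mu : 'I_m) (g : 'rV[R]_m -> R) : 'rV[R]_m -> R :=
  fun x => 'D_(delta_mx ord0 mu) g x.

Fixpoint is_Ck (k : nat) (g : 'rV[R]_m -> R) : Prop :=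
  if k is k'.+1 then
    (forall x, differentiable g x) /\ (forall mu, is_Ck k' (partial mu g))
  else continuous g.

Definition smooth (g : 'rV[R]_m -> R) : Prop := forall k, is_Ck k g.

Definition csmooth f : Prop :=
  smooth (fun x => complex.Re (f x)) /\ smooth (fun x => complex.Im (f x)).

Definition cpartial (mu : 'I_m) f : 'rV[R]_m -> R[i] := fun x =>
  Complex (partial mu (fun y => complex.Re (f y)) x)
          (partial mu (fun y => complex.Im (f y)) x).

Definition cintegral f : R[i] :=
  Complex (\int[lebesgue_rV m]_x complex.Re (f x))
          (\int[lebesgue_rV m]_x complex.Im (f x)).

Definition C0_smooth f : Prop :=
  csmooth f /\
  forall e : R, 0 < e ->
    exists2 K, compact K & forall x, ~ K x -> Normc.normc (f x) < e.

End euclidean.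

Section dirac.
Context {R : realType} {m N : nat}.
Implicit Types (s : 'rV[R]_m -> 'cV[R[i]]_N) (f : 'rV[R]_m -> R[i]).

Definition clifford (gamma : 'I_m -> 'M[R[i]]_N) : Prop :=
  (forall mu, (map_mx Num.conj (gamma mu))^T = gamma mu) /\
  (forall mu nu, gamma mu *m gamma nu + gamma nu *m gamma mu =
                 (2 * (mu == nu)%:R)%:M).

Definition dirac_op (gamma : 'I_m -> 'M[R[i]]_N) s : 'rV[R]_m -> 'cV[R[i]]_N :=
  fun x => - Complex 0 1 *:
    \sum_(mu < m) gamma mu *m \col_a cpartial mu (fun y => s y a ord0) x.

Definition dirac_comm (gamma : 'I_m -> 'M[R[i]]_N) f s :
    'rV[R]_m -> 'cV[R[i]]_N :=
  fun x => dirac_op gamma (fun y => f y *: s y) x - f x *: dirac_op gamma s x.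

Definition L2norm s : \bar R :=
  Lnorm (lebesgue_rV m) 2%:E
    (fun x => (Num.sqrt (\sum_(a < N) Normc.normc (s x a ord0) ^+ 2))%:E).

(* C_c^oo(R^m, C^N), the domain of D: a dense subspace of the L^2 spinors,
   invariant under D and under multiplication by smooth f, on which D is
   essentially self-adjoint. *)
Definition test_spinor s : Prop :=
  (forall a, csmooth (fun x => s x a ord0)) /\
  exists2 K, compact K & forall x, ~ K x -> s x = 0.

(* L^2-operator norm of an operator T with domain C_c^oo, that is, of its
   continuous extension to L^2 when finite; +oo if T is unbounded. *)
Definition opnorm (T : ('rV[R]_m -> 'cV[R[i]]_N) -> 'rV[R]_m -> 'cV[R[i]]_N) :
    \bar R :=
  ereal_sup [set L2norm (T s) | s in [set s | test_spinor s /\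
                                              (L2norm s <= 1)%E]].

(* The supremum makes sense for arbitrary functionals phi1, phi2; the distance
   is its restriction to states. *)
Definition spectral_dist (gamma : 'I_m -> 'M[R[i]]_N)
    (phi1 phi2 : ('rV[R]_m -> R[i]) -> R[i]) : \bar R :=
  ereal_sup [set (Normc.normc (phi1 f - phi2 f))%:E | f in
    [set f | C0_smooth f /\ (opnorm (dirac_comm gamma f) <= 1)%E]].

End dirac.

Definition dilated_state {R : realType} {m : nat} (psi : 'rV[R]_m -> R)
    (sigma : R) (x : 'rV[R]_m) (f : 'rV[R]_m -> R[i]) : R[i] :=
  (real_complex R (sigma ^+ m)^-1) *
  cintegral (fun xi => f xi * real_complex R (psi (sigma^-1 *: (xi - x)))).

(* Main.v *)
(** If ||[D,f]|| <= 1, testing the commutator on bump spinors chi e_j near a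
    point shows |grad Re f|^2 + |grad Im f|^2 <= 1 there, because the squared
    norms of the columns of sum_mu v_mu gamma^mu add up to N |v|^2.  Every
    combination a Re f + b Im f with a^2 + b^2 = 1 is then 1-Lipschitz, and
    integrating it along the coupling (x + sigma xi, y + sigma' xi) of the two
    states, after the substitution that turns both of them into integrals
    against psi, gives the upper bound.  For sigma <> sigma' the two dilations
    agree at one point, with value z say, and f(w) = |w - z| attains the bound:
    it is the pointwise limit, up to additive constants, of smooth functions
    vanishing at infinity with gradient at most 1, and dominated convergence
    applies.  The case sigma = sigma' follows by letting sigma' tend to sigma
    in the triangle inequality. *)
Require Import Defs.
From HB Require Import structures.
From mathcomp Require Import all_boot all_order all_algebra.
From mathcomp Require Import all_classical all_reals all_analysis measurable_realfun.
From mathcomp.real_closed Require Import complex.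
From mathcomp Require Import ring lra.

Import Order.TTheory GRing.Theory Num.Theory.
Import numFieldNormedType.Exports.

Local Open Scope classical_set_scope.
Local Open Scope ring_scope.

Set Implicit Arguments.
Unset Strict Implicit.
Unset Printing Implicit Defensive.

(** * Smooth real functions on R^m: algebra and composition *)

Section smooth_calculus.
Context {R : realType} {m : nat}.
Implicit Types (f g : 'rV[R]_m -> R) (h : R -> R) (k : nat).

(** For complex f with gradients a of Re f and b of Im f, the matrix of the commutator times its
    adjoint is |a|^2 + |b|^2 plus i times the commutator of the Clifford elements of a and b. This
    cross term need not vanish, but it has trace zero, hence the average over the columns. The
    resulting one-sided estimate is enough: every admissible f has to be shown Lipschitz, while
    admissibility has to be shown only for real potentials, where b = 0 and the matrix squares to a
    scalar. The potential |w - z| is neither smooth at z nor small at infinity. Replacing t by k - k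
    exp(-t/k), of slope at most 1 and close to t for large k, cures the second defect up to the
    constant k, which cancels in a difference of states; replacing |w - z| by a square root bounded
    away from 0 cures the first. Distinct scales matter because the maps x + sigma xi and y + sigma'
    xi then meet, and a distance to the meeting point serves every xi at once. With equal scales
    they stay a constant vector apart. *)

Lemma is_Ck_differentiable k f : is_Ck k.+1 f -> forall x, differentiable f x.
Proof. by move=> [df _] x; exact: df. Qed.

Lemma is_Ck_partial k f mu : is_Ck k.+1 f -> is_Ck k (partial mu f).
Proof. by move=> [_ pf]; exact: pf. Qed.

Lemma is_CkW k f : is_Ck k.+1 f -> is_Ck k f.
Proof.
elim: k f => [|k IH] f [df pf].
  by move=> x; exact: differentiable_continuous.
by split=> // mu; exact/IH/pf.
Qed.

Lemma smooth_differentiable f x : smooth f -> differentiable f x.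
Proof. by move=> sf; exact: (is_Ck_differentiable (sf 1%N)). Qed.

Lemma smooth_continuous f : smooth f -> continuous f.
Proof. exact: (fun sf => sf 0%N). Qed.

Lemma smooth_partial mu f : smooth f -> smooth (partial mu f).
Proof. by move=> sf k; exact: is_Ck_partial (sf k.+1). Qed.

Lemma partialD mu f g x : differentiable f x -> differentiable g x ->
  partial mu (fun y => f y + g y) x = partial mu f x + partial mu g x.
Proof. by move=> df dg; rewrite /partial deriveD//; exact: diff_derivable. Qed.

Lemma partialM mu f g x : differentiable f x -> differentiable g x ->
  partial mu (fun y => f y * g y) x = partial mu f x * g x + f x * partial mu g x.
Proof.
move=> df dg; rewrite /partial deriveM; [|exact: diff_derivable..].
by rewrite addrC [X in X + _]mulrC.
Qed.

Lemma partial_cst mu (c : R) (x : 'rV[R]_m) : partial mu (fun=> c) x = 0.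
Proof. exact: derive_cst. Qed.

Lemma partialZ mu (c : R) f x : differentiable f x ->
  partial mu (fun y => c * f y) x = c * partial mu f x.
Proof.
move=> df; rewrite (partialM _ (differentiable_cst c x) df) partial_cst.
by rewrite mul0r add0r.
Qed.

Lemma partial_sum mu n (F : 'I_n -> 'rV[R]_m -> R) x :
  (forall i, differentiable (F i) x) ->
  partial mu (fun y => \sum_(i < n) F i y) x = \sum_(i < n) partial mu (F i) x.
Proof.
move=> dF.
(* Differentiability of the sum is carried along, since [partialD] asks for it at each step of the
   induction. *)
suff [] : differentiable (fun y => \sum_(i < n) F i y) x /\
  partial mu (fun y => \sum_(i < n) F i y) x = \sum_(i < n) partial mu (F i) x by [].
elim: n F dF => [|n IH] F dF.
  under eq_fun do rewrite big_ord0.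
  by rewrite big_ord0 partial_cst; split=> //; exact: differentiable_cst.
have [dS pS] := IH _ (fun i => dF (lift ord0 i)).
under eq_fun do rewrite big_ord_recl.
by rewrite big_ord_recl partialD// pS; split=> //; exact: (differentiableD (dF ord0) dS).
Qed.

Lemma partial_coord mu i (x : 'rV[R]_m) :
  partial mu (fun y => y ord0 i) x = (i == mu)%:R.
Proof.
rewrite /partial deriveE; last exact: differentiable_coord.
pose c : 'rV[R]_m -> R := fun y => y ord0 i.
have lc : linear c by move=> a u v; rewrite /c !mxE.
pose L : {linear 'rV[R]_m -> R} := HB.pack c (GRing.isLinear.Build _ _ _ _ c lc).
rewrite -/c (_ : c = L)// diff_lin; last exact: coord_continuous.
by rewrite /= /c mxE eqxx.
Qed.

Lemma is_Ck_cst k (c : R) : is_Ck k (fun _ : 'rV[R]_m => c).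
Proof.
elim: k c => [|k IH] c; first by move=> x; exact: cst_continuous.
split=> [x|mu]; first exact: differentiable_cst.
rewrite (_ : partial mu _ = fun=> 0); first exact: IH.
by apply/funext => x; exact: partial_cst.
Qed.

Lemma smooth_cst (c : R) : smooth (fun _ : 'rV[R]_m => c).
Proof. by move=> k; exact: is_Ck_cst. Qed.

Lemma smooth_coord i : smooth (fun y : 'rV[R]_m => y ord0 i).
Proof.
case=> [|k]; first exact: coord_continuous.
split=> [x|mu]; first exact: differentiable_coord.
rewrite (_ : partial mu _ = fun=> (i == mu)%:R); first exact: is_Ck_cst.
by apply/funext => x; exact: partial_coord.
Qed.

Lemma is_CkD k f g : is_Ck k f -> is_Ck k g -> is_Ck k (fun x => f x + g x).
Proof.
elim: k f g => [|k IH] f g Cf Cg.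
  by move=> x; have := cvgD (Cf x) (Cg x); exact.
have [[df pf] [dg pg]] := (Cf, Cg).
split=> [x|mu]; first exact: (differentiableD (df x) (dg x)).
rewrite (_ : partial mu _ = fun x => partial mu f x + partial mu g x).
  by apply: IH; [exact: pf|exact: pg].
by apply/funext => x; exact: partialD.
Qed.

Lemma is_CkM k f g : is_Ck k f -> is_Ck k g -> is_Ck k (fun x => f x * g x).
Proof.
elim: k f g => [|k IH] f g Cf Cg.
  by move=> x; have := cvgM (Cf x) (Cg x); exact.
have [[df pf] [dg pg]] := (Cf, Cg).
split=> [x|mu]; first exact: (differentiableM (df x) (dg x)).
rewrite (_ : partial mu _ =
  fun x => partial mu f x * g x + f x * partial mu g x).
  by apply: is_CkD; apply: IH; do ?exact: is_CkW; [exact: pf|exact: pg].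
by apply/funext => x; exact: partialM.
Qed.

Lemma smoothD f g : smooth f -> smooth g -> smooth (fun x => f x + g x).
Proof. by move=> sf sg k; exact: is_CkD. Qed.

Lemma smoothM f g : smooth f -> smooth g -> smooth (fun x => f x * g x).
Proof. by move=> sf sg k; exact: is_CkM. Qed.

Lemma smoothZ (c : R) f : smooth f -> smooth (fun x => c * f x).
Proof. by move=> sf; apply: smoothM => //; exact: smooth_cst. Qed.

Lemma smoothB f g : smooth f -> smooth g -> smooth (fun x => f x - g x).
Proof.
move=> sf sg; rewrite (_ : (fun x => _) = fun x => f x + -1 * g x).
  by apply: smoothD => //; exact: smoothZ.
by apply/funext => x; rewrite mulN1r.
Qed.

Lemma smooth_sum n (F : 'I_n -> 'rV[R]_m -> R) :
  (forall i, smooth (F i)) -> smooth (fun x => \sum_(i < n) F i x).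
Proof.
elim: n F => [|n IH] F sF.
  by under eq_fun do rewrite big_ord0; exact: smooth_cst.
by under eq_fun do rewrite big_ord_recl; apply: smoothD => //; exact: IH.
Qed.

Lemma differentiable_comp1 h d f x : differentiable f x ->
  is_derive (f x) 1 h d -> differentiable (fun y => h (f y)) x.
Proof.
move=> df dh; apply: (@differentiable_comp _ _ _ _ f h) => //.
by apply/derivable1_diffP; exact: ex_derive.
Qed.

Lemma partial_comp mu h d f x : differentiable f x -> is_derive (f x) 1 h d ->
  partial mu (fun y => h (f y)) x = d * partial mu f x.
Proof.
move=> df dh.
have dh' : differentiable h (f x) by apply/derivable1_diffP; exact: ex_derive.
rewrite /partial deriveE; last exact: differentiable_comp1 df dh.
have lin t : 'd h (f x) t = t * 'd h (f x) 1.
  by rewrite -[in LHS](mulr1 t) -[t * 1]/(t *: 1) linearZ.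
rewrite (_ : (fun y => h (f y)) = h \o f)// diff_comp//= lin -!deriveE//.
by rewrite (@derive_val _ _ _ _ _ _ _ dh) mulrC.
Qed.

(* The hypothesis bears on h' along f only, so that h may be singular
   outside of the range of f. *)
Lemma is_Ck_comp k h h' f :
  (forall x, is_derive (f x) 1 h (h' (f x))) ->
  is_Ck k.+1 f -> is_Ck k (fun x => h' (f x)) -> is_Ck k.+1 (fun x => h (f x)).
Proof.
move=> dh [df pf] Ch'; split=> [x|mu]; first exact: differentiable_comp1.
rewrite (_ : partial mu _ = fun x => h' (f x) * partial mu f x).
  by apply: is_CkM => //; exact: pf.
by apply/funext => x; exact: partial_comp.
Qed.

(** The derivative of [expR] is [expR], so the induction hypothesis is exactly the regularity of h'
    along f that [is_Ck_comp] asks for. *)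
Lemma smooth_expR f : smooth f -> smooth (fun x => expR (f x)).
Proof.
move=> sf; elim=> [|k IH].
  by move=> x; apply: continuous_comp; [exact: sf 0%N x|exact: continuous_expR].
exact: (@is_Ck_comp _ expR expR).
Qed.

Lemma smooth_inv f : (forall x, 0 < f x) -> smooth f ->
  smooth (fun x => (f x)^-1).
Proof.
move=> f0 sf; elim=> [|k IH].
  by move=> x; apply: continuousV; [rewrite gt_eqF|exact: sf 0%N x].
apply: (@is_Ck_comp _ GRing.inv (fun t => -1 * (t^-1 * t^-1))) => //.
  move=> x; have fx0 : f x != 0 by rewrite gt_eqF.
  have := is_deriveV (f := id) fx0 (is_derive_id (f x) 1); move=> /is_derive_eq; apply.
  by rewrite /GRing.scale/= mulr1 mulN1r -exprVn expr2.
by apply: is_CkM; [exact: is_Ck_cst|exact: is_CkM].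
Qed.

Lemma smooth_sqrt f : (forall x, 0 < f x) -> smooth f ->
  smooth (fun x => Num.sqrt (f x)).
Proof.
move=> f0 sf; elim=> [|k IH].
  by move=> x; apply: continuous_comp; [exact: sf 0%N x|exact: sqrt_continuous].
(* The derivative 1 / (2 sqrt t) is written with sqrt t as a factor: the induction hypothesis and
   [smooth_inv] then apply to the two factors. *)
apply: (@is_Ck_comp _ Num.sqrt (fun t => 2^-1 * (Num.sqrt t * t^-1))) => //.
  move=> x; have := is_derive1_sqrt (f0 x); move=> /is_derive_eq; apply.
  rewrite invfM; congr (_ * _); apply: (mulfI (x := Num.sqrt (f x))).
    by rewrite gt_eqF// sqrtr_gt0.
  rewrite divff ?gt_eqF ?sqrtr_gt0// mulrA -expr2 sqr_sqrtr ?ltW//.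
  by rewrite divff// gt_eqF.
apply: is_CkM; [exact: is_Ck_cst|apply: is_CkM => //].
exact: (smooth_inv f0 sf).
Qed.

End smooth_calculus.

(** * The flat function exp(-1/t) and its derivatives *)

Section flat_function.
Context {R : realType}.
Implicit Types (t u : R) (k : nat).

(* The derivatives of the smooth flat function exp(-1/t) are combinations of
   the t^-k exp(-1/t). *)
Definition flat k t : R := if 0 < t then t^-1 ^+ k * expR (- t^-1) else 0.

Lemma flat_ge0 k t : 0 <= flat k t.
Proof.
rewrite /flat; case: ifPn => // t0; rewrite mulr_ge0 ?expR_ge0//.
by rewrite exprn_ge0// invr_ge0 ltW.
Qed.

Lemma flat0_gt0 t : 0 < t -> 0 < flat 0 t.
Proof. by move=> t0; rewrite /flat t0 expr0 mul1r expR_gt0. Qed.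

Lemma flat_le0 k t : t <= 0 -> flat k t = 0.
Proof. by rewrite /flat ltNge => ->. Qed.

(** With s = 1/t, the exponential series gives exp(s) >= s^(k+2) / (k+2)!. A quadratic bound is what
    forces the derivative at 0 to vanish, for every k. *)
Lemma flat_le k t : flat k t <= (k.+2)`!%:R * t ^+ 2.
Proof.
rewrite /flat; case: ifPn => [t0|_]; last first.
  by rewrite mulr_ge0 ?sqr_ge0.
have f0 : 0 < (k.+2)`!%:R :> R by rewrite ltr0n fact_gt0.
have s0 : 0 < t^-1 by rewrite invr_gt0.
have := expR_ge1Dxn k.+1 (ltW s0) => sE.
have {sE}sE : t^-1 ^+ k.+2 / (k.+2)`!%:R <= expR t^-1.
  by apply: le_trans sE; rewrite lerDr.
rewrite expRN ler_pdivrMr ?expR_gt0//.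
move: sE; rewrite ler_pdivrMr// => sE.
rewrite -(@ler_pM2l _ (t^-1 ^+ 2)) ?exprn_gt0// -exprD add2n.
set F := _%:R; set E := expR _.
rewrite [leRHS](_ : _ = (t^-1 * t) ^+ 2 * (E * F)); last by ring.
by rewrite mulVf ?gt_eqF// expr1n mul1r.
Qed.

Lemma flat_near0 k t : t < 0 -> \near t, 0 = flat k t.
Proof.
move=> t0; near=> u; rewrite flat_le0// ltW//; near: u.
exact: lt_nbhsl.
Unshelve. all: by end_near. Qed.

Lemma is_derive_quadratic_at0 (C : R) (F : R -> R) :
  (forall t, `|F t| <= C * t ^+ 2) -> is_derive (0 : R) (1 : R) F (0 : R).
Proof.
move=> FC; have F0 : F 0 = 0.
  by apply/normr0_eq0/eqP; rewrite eq_le normr_ge0 andbT (le_trans (FC 0))// expr0n/= mulr0.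
have C0 : 0 <= C.
  by have := FC 1; rewrite expr1n mulr1; exact: le_trans.
have cF : h^-1 *: ((F \o shift (0 : R)) (h *: (1 : R)) - F 0) @[h --> (0 : R)^'] --> (0 : R).
  apply/cvgr0Pnorm_le => e e0; near=> h.
  have h0 : h != 0 by near: h; exact: nbhs_dnbhs_neq.
  rewrite /= F0 subr0 addr0 normrZ normfV ler_pdivrMl ?normr_gt0//.
  have -> : h *: (1 : R) = h by exact: mulr1.
  rewrite (le_trans (FC h))// -real_normK ?num_real// expr2 mulrA mulrC ler_wpM2l//.
  (* C may be 0; C + 1 can be divided by. *)
  rewrite (@le_trans _ _ ((C + 1) * `|h|))//.
    by rewrite ler_wpM2r// lerDl.
  rewrite -ler_pdivlMl ?ltr_wpDl//; near: h; apply: dnbhs0_le.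
  by rewrite mulr_gt0// invr_gt0 ltr_wpDl.
by split; [apply/cvg_ex; exists 0|exact: cvg_lim].
Unshelve. all: by end_near. Qed.

(** The family is closed under derivation: the product rule applies for t > 0, [flat k] is locally 0
    for t < 0, and at 0 the quadratic bound [flat_le] takes over. *)
Lemma is_derive_flat k t :
  is_derive t 1 (flat k) (- k%:R * flat k.+1 t + flat k.+2 t).
Proof.
have [t0|t0|->] := ltgtP t 0; last 1 first.
- rewrite !flat_le0// mulr0 addr0.
  by apply: (@is_derive_quadratic_at0 (k.+2)`!%:R) => u; rewrite ger0_norm ?flat_ge0// flat_le.
- rewrite !flat_le0 ?ltW// mulr0 addr0.
  apply: (near_eq_is_derive (flat_near0 k t0)); exact: is_derive_cst.
have nt : t != 0 by rewrite gt_eqF.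
have iV := is_deriveV (f := id) nt (is_derive_id t 1).
have iE : is_derive t 1 (fun u => expR (- u^-1)) (expR (- t^-1) * t^-1 ^+ 2).
  have iN : is_derive t 1 (fun u => - u^-1) (t^-1 ^+ 2).
    have := is_deriveN iV; move=> /is_derive_eq; apply.
    by rewrite /GRing.scale/= mulr1 opprK exprVn.
  exact: (is_derive1_comp (f := expR) (g := fun u => - u^-1)).
have := is_deriveM (is_deriveX k iV) iE.
move=> /is_derive_eq H.
apply: (@near_eq_is_derive _ _ _ ((fun y => y^-1) ^+ k * (fun u => expR (- u^-1)))).
  near=> u; have u0 : 0 < u by near: u; exact: lt_nbhsr.
  by rewrite /flat u0 /= ?mulrfctE ?exprfctE.
apply: H; rewrite /flat t0 ?exprfctE /GRing.scale/= mulr1.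
rewrite -exprVn; case: k => [|k].
  by rewrite !expr0 !mul0r !mulr0 oppr0 mul0r add0r addr0 mul1r mulrC.
rewrite -pred_Sn; set s := t^-1; set E := expR _; rewrite !exprS; ring.
Unshelve. all: by end_near. Qed.

Lemma smooth_flat m (f : 'rV[R]_m -> R) k :
  smooth f -> smooth (fun x => flat k (f x)).
Proof.
move=> sf n; elim: n k => [|n IH] k.
  move=> x; apply: (@continuous_comp _ _ _ f (flat k)); first exact: sf 0%N x.
  apply/differentiable_continuous/derivable1_diffP.
  exact: (@ex_derive _ _ _ _ _ _ _ (is_derive_flat k (f x))).
apply: (@is_Ck_comp _ _ _ _ (fun t => - k%:R * flat k.+1 t + flat k.+2 t)) => //.
  by move=> x; exact: is_derive_flat.
by apply: is_CkD => //; apply: is_CkM => //; exact: is_Ck_cst.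
Qed.

End flat_function.

(** * Open sets and continuous functions are measurable *)

Section borel_rV.
Context {R : realType} {m : nat}.

Lemma measurable_box (A : 'I_m -> set R) : (forall i, measurable (A i)) ->
  measurable [set x : 'rV[R]_m | forall i, A i (x ord0 i)].
Proof.
move=> mA; rewrite [X in measurable X](_ : _ =
  \bigcap_(i in [set: 'I_m]) (fun x : 'rV[R]_m => x ord0 i) @^-1` A i).
  apply: fin_bigcap_measurable => [|i _]; first exact: finite_finset.
  by rewrite -[X in measurable X]setTI; exact: measurable_coor.
by apply/seteqP; split => x /= xA; [move=> i _|move=> i; exact: xA].
Qed.

Lemma measurable_ball_rV (x : 'rV[R]_m) (e : R) : 0 < e ->
  measurable (ball x e).
Proof.
move=> e0; rewrite [X in measurable X](_ : _ =
    [set y : 'rV[R]_m | forall i, ball (x ord0 i) e (y ord0 i)]).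
  by apply: (measurable_box (A := fun i => ball (x ord0 i) e)) => i; exact: measurable_ball.
apply/seteqP; split => y.
  by move=> [_ xy] i; exact: xy.
by move=> xy; split=> // i j; rewrite (ord1 i); exact: xy.
Qed.

(** The sigma-algebra is generated by coordinates, not by open sets. Balls of the sup norm are
    boxes, and an open set is the union of the countably many balls of rational centre and radius
    1/(n+1) that it contains. *)
Lemma open_measurable_rV (U : set 'rV[R]_m) : open U -> measurable U.
Proof.
move=> oU.
pose r (n : nat) : R := n.+1%:R^-1.
have r0 n : 0 < r n by rewrite invr_gt0.
pose B (p : 'rV[rat]_m * nat) : set 'rV[R]_m :=
  ball (map_mx (ratr : rat -> R) p.1) (r p.2).
pose F p := if `[< B p `<=` U >] then B p else set0.
rewrite (_ : U = \bigcup_p F p).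
  apply: (countable_bigcupT_measurable (countableP _)) => p; rewrite /F.
  by case: ifP => _; [exact: measurable_ball_rV|exact: measurable0].
apply/seteqP; split => [x Ux|x [p _]]; last first.
  by rewrite /F; case: asboolP => // BU /BU.
have /nbhs_ballP[e /= e0 eU] : nbhs x U by exact: open_nbhs_nbhs.
have [n ne] : exists n, r n < e / 2.
  have e20 : 0 < e / 2 by rewrite divr_gt0.
  by have [n _ /(_ _ (leqnn n))] := near_infty_natSinv_lt (PosNum e20); exists n.
have dq (i : 'I_m) : exists q : rat, `|ratr q - x ord0 i| < r n.
  have /rat_in_itvoo[q] : x ord0 i - r n < x ord0 i + r n.
    by rewrite ltrD2l gtrN.
  by rewrite in_itv/= => qx; exists q; rewrite ltr_distl.
have [q qx] := choice dq.
exists (\row_i q i, n) => //.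
have Bx : B (\row_i q i, n) x.
  split=> // i j; rewrite !mxE (ord1 i) /ball/= /ball_; exact: qx.
rewrite /F; case: asboolP => // BU; exfalso; apply: BU => y By; apply: eU.
(* Both x and y lie in the ball of radius [r n] < e/2 around the rational point. *)
apply: (@le_ball _ _ _ (r n + r n)); last exact: ball_triangle (ball_sym Bx) By.
by rewrite [leRHS]splitr lerD// ltW.
Qed.

Lemma continuous_measurable_rV (f : 'rV[R]_m -> R) :
  continuous f -> measurable_fun setT f.
Proof.
move=> /continuousP cf; apply: (measurability _ (RGenOpens.measurableE R)).
move=> _ [_ [a [b ->] <-]]; rewrite setTI; apply: open_measurable_rV.
exact/cf/interval_open.
Qed.

End borel_rV.

(** * Lebesgue measure and integrals under xi -> x + s xi *)

Section dilation.
Context {R : realType}.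

(** The right-hand side is a measure in A that gives half-open intervals their length, which
    characterises Lebesgue measure. *)
Lemma lebesgue_measure_dilation (a s : R) (A : set R) : 0 < s -> measurable A ->
  lebesgue_measure A =
  (s%:E * lebesgue_measure ((fun t : R => (a + s * t)%R) @^-1` A))%E.
Proof.
move=> s0 mA; pose phi : measurableTypeR R -> measurableTypeR R := fun t => a + s * t.
have mphi : measurable_fun setT phi.
  by apply: measurable_funD => //; exact: measurable_funM.
pose nu := mscale (NngNum (ltW s0)) (pushforward lebesgue_measure phi).
rewrite -[RHS]/(nu mphi A); apply: lebesgue_measure_unique => // _ [[b c]] _ <-.
rewrite -[RHS]/(s%:E * lebesgue_measure (phi @^-1` `]b, c]%classic))%E.
rewrite (_ : phi @^-1` _ = `](b - a) / s, (c - a) / s]%classic); last first.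
  apply/seteqP; split => t; rewrite /phi/= !in_itv/= ltr_pdivrMr// ler_pdivlMr//.
    by rewrite ltrBlDl lerBrDl [t * s]mulrC.
  by rewrite ltrBlDl lerBrDl [t * s]mulrC.
rewrite !lebesgue_measure_itv/= !lte_fin ltr_pM2r ?invr_gt0// ltrD2r.
case: ifPn => _; last by rewrite mule0.
rewrite -!EFinB -EFinM -mulrBl mulrCA divff ?gt_eqF// mulr1; congr (_%:E); ring.
Qed.

Context {m : nat}.
Implicit Types (x : 'rV[R]_m) (s : R).

Lemma measurable_dilation_rV x s :
  measurable_fun setT (fun xi : 'rV[R]_m => x + s *: xi).
Proof.
apply: measurable_fun_coor => i; under eq_fun do rewrite !mxE.
apply: measurable_funD => //; apply: measurable_funM => //.
exact: measurable_coor.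
Qed.

(** A generating family stable under intersection, on which [lebesgue_rV] is an explicit product:
    measures are compared on it. *)
Let boxes : set (set 'rV[R]_m) :=
  [set B | exists2 A : 'I_m -> set R, (forall i, measurable (A i)) &
     B = [set x : 'rV[R]_m | forall i, A i (x ord0 i)]].

Let measurable_boxes : measurable = <<s boxes >>.
Proof.
apply/seteqP; split; last first.
  apply: smallest_sub; first exact: sigma_algebra_measurable.
  by move=> _ [A mA ->]; exact: measurable_box.
apply: sub_sigma_algebra2.
rewrite -bigcup_seq => B [i _ [C mC <-]].
(* A generator constrains one coordinate; the other sides of the box are the whole line. *)
exists (fun j => if j == i then C else setT); first by move=> j; case: ifP.
rewrite setTI; apply/seteqP; split => x /=.
  by move=> Cx j; case: eqP => // ->.
by move=> /(_ i); rewrite eqxx.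
Qed.

(** On a box the one-dimensional statement applies to each side and the m factors s multiply up.
    Uniqueness of measures then needs the exhaustion by the cubes of half-side n, which have finite
    measure. *)
Lemma lebesgue_rV_dilation x s (A : set 'rV[R]_m) : 0 < s -> measurable A ->
  lebesgue_rV m A =
  ((s ^+ m)%:E * lebesgue_rV m ((fun xi => (x + s *: xi)%R) @^-1` A))%E.
Proof.
move=> s0 mA; pose phi (xi : 'rV[R]_m) := x + s *: xi.
have mphi : measurable_fun setT phi by exact: measurable_dilation_rV.
have sm0 : 0 <= s ^+ m by rewrite exprn_ge0// ltW.
pose nu := mscale (NngNum sm0) (pushforward (lebesgue_rV m) phi).
rewrite -[RHS]/(nu mphi A).
apply: (@measure_unique _ R _ boxes
  (fun n => [set y : 'rV[R]_m | forall i : 'I_m, `[- n%:R, n%:R]%classic (y ord0 i)])) => //.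
- move=> _ _ [B mB ->] [C mC ->]; exists (fun i => B i `&` C i).
    by move=> i; exact: measurableI.
  apply/seteqP; split => y /=; first by move=> [By Cy] i; split.
  by move=> BC; split => i; have [] := BC i.
- by move=> n; exists (fun=> `[- n%:R, n%:R]%classic).
- apply/seteqP; split => // y _.
  pose M := \sum_(i < m) `|y ord0 i|.
  have [n Mn] : exists n : nat, M <= n%:R.
    by exists (Num.bound M); rewrite ltW// Num.Theory.archi_boundP// sumr_ge0.
  exists n => // i /=; rewrite in_itv/= -ler_norml (le_trans _ Mn)//.
  by rewrite /M (bigD1 i)//= lerDl sumr_ge0.
- move=> _ [B mB ->].
  rewrite -[RHS]/((s ^+ m)%:E * lebesgue_rV m
    (phi @^-1` [set y : 'rV[R]_m | forall i, B i (y ord0 i)]))%E.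
  rewrite [LHS]lebesgue_rV_box// (_ : phi @^-1` _ = [set y : 'rV[R]_m | forall i,
      ((fun t => x ord0 i + s * t) @^-1` B i) (y ord0 i)]); last first.
    by apply/seteqP; split => y /= By i; have := By i; rewrite !mxE.
  have mB' i : measurable ((fun t : R => x ord0 i + s * t) @^-1` B i).
    rewrite -[X in measurable X]setTI.
    have : measurable_fun setT (fun t : R => x ord0 i + s * t).
      by apply: measurable_funD => //; exact: measurable_funM.
    by move=> /(_ measurableT _ (mB i)).
  rewrite (lebesgue_rV_box mB').
  rewrite (eq_bigr _ (fun i _ => lebesgue_measure_dilation (x ord0 i) s0 (mB i))).
  by rewrite big_split/= prodEFin prodr_const card_ord.
- move=> n.
  have mI (i : 'I_m) : measurable `[- n%:R, n%:R : R]%classic by [].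
  apply: (@le_lt_trans _ _ (\prod_(i < m) (n%:R + n%:R)%:E)%E); last first.
    by rewrite prodEFin ltry.
  rewrite le_eqVlt; apply/orP; left; apply/eqP.
  apply: (etrans (lebesgue_rV_box mI)); apply: eq_bigr => i _.
  (* For n = 0 the interval is a point, and its measure 0 is still n + n. *)
  rewrite lebesgue_measure_itv/= lte_fin; case: ifPn => [_|].
    by rewrite -EFinB opprK.
  rewrite -leNgt => n0; congr EFin; apply/eqP.
  rewrite eq_le addr_ge0//= -subr_ge0 opprD.
  by have := n0; lra.
Qed.

Lemma ge0_integral_dilation x s (F : 'rV[R]_m -> \bar R) : 0 < s ->
  measurable_fun setT F -> (forall y, (0 <= F y)%E) ->
  (\int[lebesgue_rV m]_y F y =
   (s ^+ m)%:E * \int[lebesgue_rV m]_y F (x + s *: y)%R)%E.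
Proof.
move=> s0 mF F0; pose phi (xi : 'rV[R]_m) := x + s *: xi.
have mphi : measurable_fun setT phi by exact: measurable_dilation_rV.
have sm0 : 0 <= s ^+ m by rewrite exprn_ge0// ltW.
pose nu := mscale (NngNum sm0) (pushforward (lebesgue_rV m) phi).
rewrite (@eq_measure_integral _ _ _ _ (nu mphi)); last first.
  by move=> A mA _; exact: lebesgue_rV_dilation.
rewrite ge0_integral_mscale//=; congr (_ * _)%E.
by rewrite ge0_integral_pushforward//= preimage_setT.
Qed.

(** Integrability is asked of the pullback, the function that later gets multiplied by [psi]. It
    makes the integrals of both the positive and the negative part finite, so that the factor
    distributes over their difference. *)
Lemma integral_dilation x s (F : 'rV[R]_m -> R) : 0 < s ->
  measurable_fun setT F ->
  (lebesgue_rV m).-integrable setT (fun y => (F (x + s *: y)%R)%:E) ->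
  \int[lebesgue_rV m]_y F y = s ^+ m * \int[lebesgue_rV m]_y F (x + s *: y).
Proof.
move=> s0 mF iF; rewrite /Rintegral integralE [in RHS]integralE.
have mF' : measurable_fun setT (EFin \o F) by exact/measurable_EFinP.
rewrite (ge0_integral_dilation x s0)//; last exact: measurable_funepos.
rewrite [X in fine (_ - X) = _](ge0_integral_dilation x s0)//; last first.
  exact: measurable_funeneg.
pose G y := (F (x + s *: y)%R)%:E.
set P := (\int[lebesgue_rV m]_y (G^\+)%E y)%E.
set N := (\int[lebesgue_rV m]_y (G^\-)%E y)%E.
have Pfin : P \is a fin_num by exact: integrable_pos_fin_num.
have Nfin : N \is a fin_num by exact: integrable_neg_fin_num.
transitivity (fine ((s ^+ m)%:E * P - (s ^+ m)%:E * N)%E).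
  by congr (fine (_ * _ - _ * _)); apply: eq_integral => y _; rewrite ?funeposE ?funenegE.
rewrite -[RHS]/(s ^+ m * fine (P - N)%E) -(fineK Pfin) -(fineK Nfin).
by rewrite -!EFinM -!EFinB/= mulrBr.
Qed.

End dilation.

(** * The Euclidean norm; gradients and Lipschitz bounds *)

Section euclidean_norm.
Context {R : realType} {m : nat}.
Implicit Types (x y z w : 'rV[R]_m).

Lemma cauchy_schwarz_sum n (a b : 'I_n -> R) :
  `|\sum_(i < n) a i * b i| <=
  Num.sqrt (\sum_(i < n) a i ^+ 2) * Num.sqrt (\sum_(i < n) b i ^+ 2).
Proof.
set A := \sum_(i < n) a i ^+ 2; set B := \sum_(i < n) b i ^+ 2.
set C := \sum_(i < n) a i * b i.
have A0 : 0 <= A by apply: sumr_ge0 => i _; exact: sqr_ge0.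
have B0 : 0 <= B by apply: sumr_ge0 => i _; exact: sqr_ge0.
have [B00|Bn0] := eqVneq B 0.
  have b0 i : b i = 0.
    have := B00 => /eqP; rewrite psumr_eq0; last by move=> ? _; exact: sqr_ge0.
    by move=> /allP/(_ i); rewrite mem_index_enum sqrf_eq0 => /(_ isT)/eqP.
  rewrite /C big1 ?normr0 ?mulr_ge0 ?sqrtr_ge0// => i _.
  by rewrite b0 mulr0.
have Bgt0 : 0 < B by rewrite lt_def Bn0.
(* This sum of squares expands to B (A B - C^2); B is then divided out, whence the separate case B =
   0. *)
have : 0 <= \sum_(i < n) (B * a i - C * b i) ^+ 2.
  by apply: sumr_ge0 => i _; exact: sqr_ge0.
rewrite (eq_bigr (fun i => B ^+ 2 * a i ^+ 2 + (- 2 * B * C) * (a i * b i) +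
  C ^+ 2 * b i ^+ 2)); last by move=> i _; ring.
rewrite !big_split/= -!mulr_sumr -/A -/B -/C => H.
have {}H : 0 <= B * (A * B - C ^+ 2)
  by apply: le_trans H _; rewrite le_eqVlt; apply/orP; left; apply/eqP; ring.
rewrite -sqrtrM// -sqrtr_sqr; apply: ler_wsqrtr.
by rewrite -subr_ge0 -(pmulr_rge0 _ Bgt0).
Qed.

Lemma enorm_ge0 x : 0 <= enorm x.
Proof. exact: sqrtr_ge0. Qed.

Lemma sqr_enorm x : enorm x ^+ 2 = \sum_(i < m) x ord0 i ^+ 2.
Proof. by rewrite sqr_sqrtr// sumr_ge0// => i _; exact: sqr_ge0. Qed.

Lemma enormZ (s : R) x : enorm (s *: x) = `|s| * enorm x.
Proof.
rewrite /enorm (eq_bigr (fun i => s ^+ 2 * x ord0 i ^+ 2)); last first.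
  by move=> i _; rewrite mxE exprMn.
by rewrite -mulr_sumr sqrtrM ?sqr_ge0// sqrtr_sqr.
Qed.

Lemma enormN x : enorm (- x) = enorm x.
Proof. by rewrite -scaleN1r enormZ normrN1 mul1r. Qed.

Lemma enorm_distC x y : enorm (x - y) = enorm (y - x).
Proof. by rewrite -enormN opprB. Qed.

Lemma ler_enormD x y : enorm (x + y) <= enorm x + enorm y.
Proof.
rewrite -[leRHS]ger0_norm ?addr_ge0 ?enorm_ge0// -sqrtr_sqr.
apply: ler_wsqrtr; rewrite sqrrD !sqr_enorm.
under eq_bigr do rewrite mxE sqrrD.
rewrite big_split big_split/= sumrMnl lerD2r lerD2l lerMn2r/=.
exact: le_trans (ler_norm _) (cauchy_schwarz_sum _ _).
Qed.

Lemma ler_dist_enorm x y : `|enorm x - enorm y| <= enorm (x - y).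
Proof.
wlog: x y / enorm y <= enorm x => [wl|yx].
  have [/wl//|/ltW/wl] := leP (enorm y) (enorm x).
  by rewrite distrC enorm_distC.
rewrite ger0_norm ?subr_ge0// lerBlDr -[in leLHS](subrK y x).
exact: ler_enormD.
Qed.

Lemma smooth_sqr_dist z :
  smooth (fun x : 'rV[R]_m => \sum_(i < m) (x ord0 i - z ord0 i) ^+ 2).
Proof.
apply: smooth_sum => i; under eq_fun do rewrite expr2.
by apply: smoothM; (apply: smoothB; [exact: smooth_coord|exact: smooth_cst]).
Qed.

Lemma continuous_enorm : continuous (@enorm R m).
Proof.
move=> x; apply: continuous_comp; last exact: sqrt_continuous.
have := smooth_continuous (smooth_sqr_dist 0) (x := x).
rewrite (_ : (fun x : 'rV[R]_m => _) = fun x : 'rV[R]_m => \sum_(i < m) x ord0 i ^+ 2)//.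
by apply/funext => y; apply: eq_bigr => i _; rewrite mxE subr0.
Qed.

Lemma measurable_enorm : measurable_fun setT (@enorm R m).
Proof. by apply: continuous_measurable_rV; exact: continuous_enorm. Qed.

Lemma derive_partial (g : 'rV[R]_m -> R) x w : differentiable g x ->
  'D_w g x = \sum_(i < m) w ord0 i * partial i g x.
Proof.
move=> dg; rewrite deriveE// {1}(row_sum_delta w) linear_sum.
by apply: eq_bigr => i _; rewrite linearZ /partial deriveE.
Qed.

Lemma is_derive_line (g : 'rV[R]_m -> R) x w (t : R) : differentiable g (x + t *: w) ->
  is_derive t 1 (fun s => g (x + s *: w)) ('D_w g (x + t *: w)).
Proof.
move=> dg; have dw : derivable g (x + t *: w) w by exact: diff_derivable.
(* The difference quotients of the restriction to the line are those of g in the direction w. *)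
have E : (fun h : R => h^-1 *: (((fun s => g (x + s *: w)) \o shift t) (h *: 1) -
    g (x + t *: w))) =
  (fun h : R => h^-1 *: ((g \o shift (x + t *: w)) (h *: w) - g (x + t *: w))).
  apply/funext => h /=; congr (_ *: (g _ - _)).
  by rewrite -[h *: 1]/(h * 1) mulr1 scalerDl addrCA.
by split; rewrite /derivable /derive E.
Qed.

(** Mean value theorem on the segment from y to x, then Cauchy-Schwarz for the directional
    derivative. *)
Lemma gradient_le1_lipschitz (g : 'rV[R]_m -> R) :
  (forall x, differentiable g x) ->
  (forall x, \sum_(mu < m) partial mu g x ^+ 2 <= 1) ->
  forall x y, `|g x - g y| <= enorm (x - y).
Proof.
move=> dg g1 x y; pose w := x - y; pose h (t : R) := g (y + t *: w).
have dh (t : R) : is_derive t 1 h ('D_w g (y + t *: w)) by exact: is_derive_line.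
have ch : {within `[0 : R, 1], continuous h}.
  apply: continuous_subspaceT => t.
  exact/differentiable_continuous/derivable1_diffP/(@ex_derive _ _ _ _ _ _ _ (dh t)).
have [t _] := MVT ltr01 (fun t _ => dh t) ch.
rewrite /h scale1r scale0r addr0 subr0 mulr1 [y + w]addrC subrK => ->.
rewrite derive_partial//; apply: le_trans (cauchy_schwarz_sum _ _) _.
by rewrite -[leRHS]mulr1 ler_wpM2l ?sqrtr_ge0// -sqrtr1 ler_wsqrtr.
Qed.

End euclidean_norm.

(** * Clifford multiplication and norms of spinors *)

Section clifford_norm.
Context {R : realType} {m N : nat}.
Implicit Types (z : R[i]) (w : 'cV[R[i]]_N).

Lemma sqr_normcE z :
  Normc.normc z ^+ 2 = complex.Re z ^+ 2 + complex.Im z ^+ 2.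
Proof. by case: z => a b; rewrite /= sqr_sqrtr// addr_ge0 ?sqr_ge0. Qed.

Lemma sqr_normc_conj z : real_complex R (Normc.normc z ^+ 2) = Num.conj z * z.
Proof.
rewrite sqr_normcE; case: z => a b /=.
by apply/eqP; rewrite eq_complex; apply/andP; split; apply/eqP => /=; ring.
Qed.

Definition spinor_sqr w : R := \sum_(a < N) Normc.normc (w a ord0) ^+ 2.

Lemma spinor_sqr_ge0 w : 0 <= spinor_sqr w.
Proof. by apply: sumr_ge0 => a _; exact: sqr_ge0. Qed.

Definition adjoint n p (A : 'M[R[i]]_(n, p)) : 'M[R[i]]_(p, n) :=
  (map_mx Num.conj A)^T.

Lemma adjointM n p q (A : 'M[R[i]]_(n, p)) (B : 'M[R[i]]_(p, q)) :
  adjoint (A *m B) = adjoint B *m adjoint A.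
Proof. by rewrite /adjoint map_mxM trmx_mul. Qed.

Lemma spinor_sqr_adjoint w :
  (real_complex R (spinor_sqr w))%:M = adjoint w *m w.
Proof.
apply/matrixP => i j; rewrite !ord1 !mxE mulr1n rmorph_sum/=.
by apply: eq_bigr => a _; rewrite !mxE sqr_normc_conj.
Qed.

Lemma spinor_sqrZ z w : spinor_sqr (z *: w) = Normc.normc z ^+ 2 * spinor_sqr w.
Proof.
rewrite /spinor_sqr mulr_sumr; apply: eq_bigr => a _.
by rewrite mxE Normc.normcM exprMn.
Qed.

Variables (gamma : 'I_m -> 'M[R[i]]_N) (gammaP : clifford gamma).
Implicit Types (v : 'I_m -> R[i]).

(** Clifford multiplication by the covector v, the Feynman slash; v is complex because f is. *)
Definition slash v : 'M[R[i]]_N := \sum_(mu < m) v mu *: gamma mu.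

Lemma adjoint_slash v : adjoint (slash v) = slash (fun mu => Num.conj (v mu)).
Proof.
rewrite /adjoint /slash raddf_sum linear_sum; apply: eq_bigr => mu _ /=.
by rewrite map_mxZ linearZ/= (proj1 gammaP).
Qed.

Lemma slash_mul u v :
  slash u *m slash v =
  \sum_(mu < m) \sum_(nu < m) (u mu * v nu) *: (gamma mu *m gamma nu).
Proof.
rewrite /slash mulmx_suml; apply: eq_bigr => mu _.
rewrite mulmx_sumr; apply: eq_bigr => nu _.
by rewrite -scalemxAl -scalemxAr scalerA.
Qed.

Lemma slash_sqr v : slash v *m slash v = (\sum_(mu < m) v mu ^+ 2)%:M.
Proof.
have two0 : (2 : R[i]) != 0 by rewrite pnatr_eq0.
(* Twice the double sum is the sum plus its transpose, in which the products of gammas pair up into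
   anticommutators. *)
apply: (scalerI two0); rewrite slash_mul !scaler_nat mulr2n.
rewrite [X in _ + X]exchange_big/= -big_split/=.
rewrite (eq_bigr (fun mu => (2 * v mu ^+ 2)%:M)).
  by rewrite -!raddf_sum/= -mulr_sumr -scaler_nat -scale_scalar_mx scaler_nat.
move=> mu _; rewrite -big_split/=.
rewrite (eq_bigr (fun nu => (v mu * v nu * (2 * (mu == nu)%:R))%:M)); last first.
  move=> nu _; rewrite [v nu * v mu]mulrC -scalerDr (proj2 gammaP).
  by rewrite scale_scalar_mx.
rewrite (bigD1 mu)//= eqxx mulr1 big1 ?addr0 => [|nu /negbTE numu].
  by congr (_%:M); ring.
by rewrite eq_sym numu !mulr0 raddf0.
Qed.

(** By cyclicity, the trace of the product is half the trace of the anticommutator. *)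
Lemma trace_gammaM mu nu : \tr (gamma mu *m gamma nu) = (mu == nu)%:R * N%:R.
Proof.
have two0 : (2 : R[i]) != 0 by rewrite pnatr_eq0.
apply: (mulfI two0); rewrite [LHS]mulr_natl mulr2n {2}mxtrace_mulC -mxtraceD.
by rewrite (proj2 gammaP) mxtrace_scalar -[LHS]mulr_natr mulrA.
Qed.

(** For a real covector [slash] is self-adjoint with scalar square, hence |r| times an isometry. *)
Lemma spinor_sqr_slash_real (r : 'I_m -> R) w :
  spinor_sqr (slash (fun mu => real_complex R (r mu)) *m w) =
  (\sum_(mu < m) r mu ^+ 2) * spinor_sqr w.
Proof.
set v := fun mu => _.
have vC : (fun mu => Num.conj (v mu)) = v.
  apply/funext => mu; exact: conjc_real.
have := spinor_sqr_adjoint (slash v *m w).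
rewrite adjointM adjoint_slash vC mulmxA -(mulmxA (adjoint w)) slash_sqr.
rewrite mul_mx_scalar -scalemxAl -spinor_sqr_adjoint scale_scalar_mx.
move=> /(congr1 (fun A : 'M[R[i]]_(1, 1) => A ord0 ord0)); rewrite !mxE !mulr1n.
rewrite /v (eq_bigr (fun mu => real_complex R (r mu ^+ 2))); last first.
  by move=> mu _; rewrite rmorphXn.
by rewrite -rmorph_sum -rmorphM => -[].
Qed.

(** For complex v the adjoint is [slash] of the conjugate and the product of the two need not be
    scalar. Its trace retains only the diagonal terms, by [trace_gammaM], and some column reaches
    the mean. *)
Lemma spinor_sqr_slash_basis v : (0 < N)%N ->
  exists j : 'I_N, \sum_(mu < m) Normc.normc (v mu) ^+ 2 <=
    spinor_sqr (slash v *m delta_mx j ord0).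
Proof.
move=> N0; set V := \sum_(mu < m) _.
have sumE : \sum_(j < N) spinor_sqr (slash v *m delta_mx j ord0) = N%:R * V.
  apply: (fmorph_inj (real_complex R)).
  transitivity (\tr (adjoint (slash v) *m slash v)).
    rewrite rmorph_sum/=; apply: eq_bigr => j _.
    have := spinor_sqr_adjoint (slash v *m delta_mx j ord0).
    move=> /(congr1 (fun A : 'M[R[i]]_(1, 1) => A ord0 ord0)); rewrite mxE mulr1n => ->.
    by rewrite -colE !mxE; apply: eq_bigr => a _; rewrite !mxE.
  rewrite adjoint_slash slash_mul raddf_sum/= rmorphM rmorph_nat rmorph_sum mulr_sumr.
  apply: eq_bigr => mu _; rewrite raddf_sum/= (bigD1 mu)//= big1 => [|nu numu].
    by rewrite addr0 mxtraceZ trace_gammaM eqxx mul1r sqr_normc_conj mulrC.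
  by rewrite mxtraceZ trace_gammaM eq_sym (negbTE numu) mul0r mulr0.
apply/existsP; rewrite -[X in is_true X]negbK; apply/negP => /existsPn /= H.
have : \sum_(j < N) spinor_sqr (slash v *m delta_mx j ord0) < \sum_(j < N) V.
  apply: ltr_sum => [|j _]; last by rewrite ltNge; exact: H.
  (* A strict inequality between sums needs a nonempty index range. *)
  by apply/hasP; exists (Ordinal N0) => //; rewrite mem_index_enum.
by rewrite sumE sumr_const card_ord mulr_natl ltxx.
Qed.

End clifford_norm.

(** * The commutator [D,f] as a multiplication operator *)

Section dirac_commutator.
Context {R : realType} {m N : nat} (gamma : 'I_m -> 'M[R[i]]_N).
Implicit Types (f g : 'rV[R]_m -> R[i]) (s : 'rV[R]_m -> 'cV[R[i]]_N).

Lemma cpartialM mu f g x : csmooth f -> csmooth g ->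
  cpartial mu (fun y => f y * g y) x = cpartial mu f x * g x + f x * cpartial mu g x.
Proof.
move=> [fr fi] [gr gi]; rewrite /cpartial.
have re : (fun y => complex.Re (f y * g y)) = fun y =>
    complex.Re (f y) * complex.Re (g y) - complex.Im (f y) * complex.Im (g y).
  by apply/funext => y; case: (f y) => a b; case: (g y).
have im : (fun y => complex.Im (f y * g y)) = fun y =>
    complex.Re (f y) * complex.Im (g y) + complex.Im (f y) * complex.Re (g y).
  by apply/funext => y; case: (f y) => a b; case: (g y).
rewrite re im.
have D h1 h2 : smooth h1 -> smooth h2 -> differentiable (fun y => h1 y * h2 y) x.
  by move=> s1 s2; apply: smooth_differentiable; exact: smoothM.
have -> : (fun y => complex.Re (f y) * complex.Re (g y) -
      complex.Im (f y) * complex.Im (g y)) =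
    fun y => complex.Re (f y) * complex.Re (g y) +
      -1 * (complex.Im (f y) * complex.Im (g y)).
  by apply/funext => y; rewrite mulN1r.
rewrite partialD; [|exact: D|apply: smooth_differentiable; apply: smoothZ; exact: smoothM].
rewrite (partialZ _ _ (D _ _ fi gi)) [in X in Complex _ X]partialD; [|exact: D..].
rewrite !partialM; do ?exact: smooth_differentiable.
case: (f x) => a b; case: (g x) => c d /=.
by apply/eqP; rewrite eq_complex /=; apply/andP; split; apply/eqP; ring.
Qed.

(** By the Leibniz rule the derivatives of s cancel, so the commutator acts pointwise. *)
Lemma dirac_commE f s x : csmooth f -> (forall a, csmooth (fun y => s y a ord0)) ->
  dirac_comm gamma f s x =
  - Complex 0 1 *: (slash gamma (fun mu => cpartial mu f x) *m s x).
Proof.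
move=> sf ss; rewrite /dirac_comm /dirac_op scalerA mulrC -scalerA -scalerBr.
congr (_ *: _); rewrite /slash mulmx_suml scaler_sumr -sumrB.
apply: eq_bigr => mu _.
rewrite -scalemxAl !scalemxAr -mulmxBr; congr (_ *m _).
apply/colP => a; rewrite !mxE.
under [in LHS]eq_fun do rewrite mxE.
by rewrite cpartialM// addrK.
Qed.

Lemma spinor_sqr_dirac_comm f s x :
  csmooth f -> (forall a, csmooth (fun y => s y a ord0)) ->
  spinor_sqr (dirac_comm gamma f s x) =
  spinor_sqr (slash gamma (fun mu => cpartial mu f x) *m s x).
Proof.
move=> sf ss; rewrite dirac_commE// spinor_sqrZ [X in X ^+ 2](_ : _ = 1).
  by rewrite expr1n mul1r.
by rewrite /= oppr0 expr0n/= sqrrN expr1n add0r sqrtr1.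
Qed.

End dirac_commutator.

(** * Smooth complex functions and spinor fields *)

Section complex_smooth.
Context {R : realType} {m N : nat}.
Implicit Types (f g : 'rV[R]_m -> R[i]).

Lemma csmooth_real (g : 'rV[R]_m -> R) :
  smooth g -> csmooth (fun x => real_complex R (g x)).
Proof. by move=> sg; split=> //=; exact: smooth_cst. Qed.

Lemma csmooth_cst (c : R[i]) : csmooth (fun _ : 'rV[R]_m => c).
Proof. by split; exact: smooth_cst. Qed.

Lemma csmoothD f g : csmooth f -> csmooth g -> csmooth (fun x => f x + g x).
Proof.
move=> [fr fi] [gr gi]; split.
  rewrite (_ : (fun x => _) = fun x => complex.Re (f x) + complex.Re (g x)).
    exact: smoothD.
  by apply/funext => x; case: (f x) => ? ?; case: (g x).
rewrite (_ : (fun x => _) = fun x => complex.Im (f x) + complex.Im (g x)).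
  exact: smoothD.
by apply/funext => x; case: (f x) => ? ?; case: (g x).
Qed.

Lemma csmoothM f g : csmooth f -> csmooth g -> csmooth (fun x => f x * g x).
Proof.
move=> [fr fi] [gr gi]; split.
  rewrite (_ : (fun x => _) = fun x => complex.Re (f x) * complex.Re (g x) -
      complex.Im (f x) * complex.Im (g x)).
    by apply: smoothB; exact: smoothM.
  by apply/funext => x; case: (f x) => ? ?; case: (g x).
rewrite (_ : (fun x => _) = fun x => complex.Re (f x) * complex.Im (g x) +
    complex.Im (f x) * complex.Re (g x)).
  by apply: smoothD; exact: smoothM.
by apply/funext => x; case: (f x) => ? ?; case: (g x).
Qed.

Lemma csmooth_sum n (F : 'I_n -> 'rV[R]_m -> R[i]) :
  (forall i, csmooth (F i)) -> csmooth (fun x => \sum_(i < n) F i x).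
Proof.
elim: n F => [|n IH] F sF.
  by under eq_fun do rewrite big_ord0; exact: csmooth_cst.
by under eq_fun do rewrite big_ord_recl; apply: csmoothD => //; exact: IH.
Qed.

Lemma csmooth_cpartial mu f : csmooth f -> csmooth (cpartial mu f).
Proof. by move=> [fr fi]; split; exact: smooth_partial. Qed.

Lemma smooth_sqr_normc f : csmooth f ->
  smooth (fun x => Normc.normc (f x) ^+ 2).
Proof.
move=> [fr fi]; under eq_fun do rewrite sqr_normcE !expr2.
by apply: smoothD; exact: smoothM.
Qed.

Lemma smooth_spinor_sqr (s : 'rV[R]_m -> 'cV[R[i]]_N) :
  (forall a, csmooth (fun x => s x a ord0)) -> smooth (fun x => spinor_sqr (s x)).
Proof. by move=> ss; apply: smooth_sum => a; exact: smooth_sqr_normc. Qed.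

Lemma csmooth_slash (gamma : 'I_m -> 'M[R[i]]_N) (v : 'rV[R]_m -> 'I_m -> R[i])
    (s : 'rV[R]_m -> 'cV[R[i]]_N) :
  (forall mu, csmooth (v^~ mu)) -> (forall a, csmooth (fun x => s x a ord0)) ->
  forall a, csmooth (fun x => (slash gamma (v x) *m s x) a ord0).
Proof.
move=> sv ss a.
rewrite (_ : (fun x => _) = fun x =>
    \sum_(b < N) (\sum_(mu < m) v x mu * gamma mu a b) * s x b ord0).
  apply: csmooth_sum => b; apply: csmoothM => //.
  by apply: csmooth_sum => mu; apply: csmoothM => //; exact: csmooth_cst.
apply/funext => x; rewrite mxE; apply: eq_bigr => b _; congr (_ * _).
by rewrite /slash summxE; apply: eq_bigr => mu _; rewrite mxE.
Qed.

End complex_smooth.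

(** * Operator norm of the commutator versus the gradient *)

Section L2_bounds.
Context {R : realType} {m N : nat}.
Implicit Types (s : 'rV[R]_m -> 'cV[R[i]]_N).

Lemma smooth_measurable_fun (g : 'rV[R]_m -> R) : smooth g ->
  measurable_fun setT g.
Proof.
by move=> sg; apply: continuous_measurable_rV; exact: smooth_continuous.
Qed.

Lemma smooth_measurable_EFin (g : 'rV[R]_m -> R) : smooth g ->
  measurable_fun setT (EFin \o g).
Proof. by move=> sg; apply/measurable_EFinP; exact: smooth_measurable_fun. Qed.

(** A bound by 1 survives squaring, so all operator norm estimates reduce to comparing integrals of
    [spinor_sqr]. *)
Lemma L2norm_le1 s :
  (L2norm s <= 1)%E <-> (\int[lebesgue_rV m]_x (spinor_sqr (s x))%:E <= 1)%E.
Proof.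
have two0 : (2 : R) != 0 by rewrite pnatr_eq0.
have -> : (\int[lebesgue_rV m]_x (spinor_sqr (s x))%:E)%E = (L2norm s `^ 2)%E.
  rewrite poweR_Lnorm//; apply: eq_integral => x _ /=.
  rewrite ger0_norm ?sqrtr_ge0// powR_mulrn ?sqrtr_ge0// sqr_sqrtr//.
  exact: spinor_sqr_ge0.
have : (0 <= L2norm s)%E by exact: Lnorm_ge0.
case: (L2norm s) => [r| |]//= r0.
  by rewrite powR_mulrn// !lee_fin expr_le1.
by rewrite (negbTE two0).
Qed.

Lemma lebesgue_rV_ball (p : 'rV[R]_m) (e : R) : 0 < e ->
  lebesgue_rV m (ball p e) = (\prod_(i < m) (e *+ 2)%:E)%E.
Proof.
move=> e0; have mb (i : 'I_m) : measurable (ball (p ord0 i) e).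
  exact: measurable_ball.
transitivity (\prod_(i < m) lebesgue_measure (ball (p ord0 i) e))%E; last first.
  by apply: eq_bigr => i _; rewrite lebesgue_measure_ball// ltW.
apply: etrans (lebesgue_rV_box mb); congr (lebesgue_rV m _).
apply/seteqP; split => y; first by move=> [_ py] i; exact: py.
by move=> py; split=> // i j; rewrite (ord1 i); exact: py.
Qed.

Lemma integral_gt0_continuous (h : 'rV[R]_m -> R) p :
  continuous h -> (forall x, 0 <= h x) -> 0 < h p ->
  (0 < \int[lebesgue_rV m]_x (h x)%:E)%E.
Proof.
move=> ch h0 hp.
have /nbhs_ballP[e /= e0 eh] : \forall x \near p, h p / 2 < h x.
  by apply: (cvgr_gt _ (ch p)); rewrite ltr_pdivrMr// mulr_natr mulr2n ltrDl.
have mB : measurable (ball p e) by exact: measurable_ball_rV.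
have mh : measurable_fun setT (EFin \o h).
  by apply/measurable_EFinP; exact: continuous_measurable_rV.
apply: (@lt_le_trans _ _ (\int[lebesgue_rV m]_(x in ball p e) (h p / 2)%:E)%E).
  have Bp : (0 < lebesgue_rV m (ball p e))%E.
    rewrite lebesgue_rV_ball// prodEFin lte_fin prodr_gt0// => i _.
    by rewrite mulrn_wgt0.
  rewrite integral_cst//; apply: mule_gt0; last exact: Bp.
  by rewrite lte_fin divr_gt0.
apply: (@le_trans _ _ (\int[lebesgue_rV m]_(x in ball p e) (h x)%:E)%E).
  apply: ge0_le_integral => //.
  - by move=> x _; rewrite lee_fin divr_ge0// ltW.
  - exact: measurable_funTS mh.
  - by move=> x /eh; rewrite lee_fin => /ltW.
apply: ge0_subset_integral => //.
by move=> x _; rewrite lee_fin.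
Qed.

Lemma exists_bump (p : 'rV[R]_m) (e : R) : 0 < e ->
  exists chi : 'rV[R]_m -> R, [/\ smooth chi,
    exists2 K, compact K & forall x, ~ K x -> chi x = 0,
    forall x, ~ ball p e x -> chi x = 0 &
    (\int[lebesgue_rV m]_x (chi x ^+ 2)%:E = 1)%E].
Proof.
move=> e0; pose d := e / 2; have d0 : 0 < d by rewrite divr_gt0.
pose chi (x : 'rV[R]_m) := flat 0 (d ^+ 2 - \sum_(i < m) (x ord0 i - p ord0 i) ^+ 2).
have schi : smooth chi.
  by apply: smooth_flat; apply: smoothB; [exact: smooth_cst|exact: smooth_sqr_dist].
(* [chi] lives on a Euclidean ball of radius d. The closed cube around it is a compact box of
   explicit measure, contained in the sup-norm ball of radius e = 2 d. *)
pose K := [set x : 'rV[R]_m | forall i, `[p ord0 i - d, p ord0 i + d]%classic (x ord0 i)].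
have cK : compact K.
  by apply: (rV_compact (A := fun i => `[p ord0 i - d, p ord0 i + d]%classic)) => i;
    exact: segment_compact.
have K0 x : ~ K x -> chi x = 0.
  move=> nK; apply/eqP; apply: contra_notT nK => chix i.
  have /lt_le_trans : \sum_(i < m) (x ord0 i - p ord0 i) ^+ 2 < d ^+ 2.
    by rewrite ltNge; apply: contraNN chix => ?; rewrite /chi flat_le0// subr_le0.
  rewrite /= in_itv/= -ler_distl -ler_sqr ?nnegrE ?(ltW d0)// real_normK ?num_real//.
  move=> H; rewrite ltW//; apply: le_lt_trans (H _ (lexx _)).
  by rewrite (bigD1 i)//= lerDl sumr_ge0// => j _; exact: sqr_ge0.
have Kb : K `<=` ball p e.
  move=> x Kx; split=> // i j; rewrite (ord1 i) /ball/= distrC.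
  have := Kx j; rewrite /= in_itv/= -ler_distl => /le_lt_trans; apply.
  by rewrite ltr_pdivrMr// mulr_natr mulr2n ltrDl.
have schi2 : smooth (fun x => chi x ^+ 2).
  by under eq_fun do rewrite expr2; exact: smoothM.
pose I := (\int[lebesgue_rV m]_x (chi x ^+ 2)%:E)%E.
have I0 : (0 < I)%E.
  apply: (@integral_gt0_continuous _ p) => [|x|].
  - exact: smooth_continuous.
  - exact: sqr_ge0.
  - rewrite exprn_gt0// flat0_gt0// big1 ?subr0 ?exprn_gt0// => i _.
    by rewrite subrr expr0n.
have mI (i : 'I_m) : measurable (`[p ord0 i - d, p ord0 i + d]%classic : set R) by [].
have mK : measurable K := measurable_box mI.
have Ioo : (I < +oo)%E.
  (* Since exp(-1/t) <= 1, the square of [chi] is at most the indicator of K. *)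
  apply: (@le_lt_trans _ _ (\int[lebesgue_rV m]_x (\1_K x)%:E)%E).
    apply: ge0_le_integral => //.
    - by move=> x _; rewrite lee_fin sqr_ge0.
    - exact: smooth_measurable_EFin.
    - by apply/measurable_EFinP; exact: measurable_indic.
    - move=> x _; rewrite lee_fin indicE; case: (pselect (K x)) => Kx; last first.
        by rewrite K0// expr0n.
      rewrite mem_set// expr_le1 ?flat_ge0// /chi /flat; case: ifPn => // t0.
      by rewrite expr0 mul1r expR_le1 oppr_le0 invr_ge0 ltW.
  have KE : lebesgue_rV m K = (\prod_(i < m) (d + d)%:E)%E.
    apply: etrans (lebesgue_rV_box mI) _; apply: eq_bigr => i _.
    rewrite lebesgue_measure_itv/= lte_fin -subr_gt0.
    have -> : p ord0 i + d - (p ord0 i - d) = d + d by ring.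
    by rewrite addr_gt0// -EFinB; congr (_%:E); ring.
  by rewrite integral_indic// setIT [X in (X < _)%E]KE prodEFin ltry.
have If : I \is a fin_num by rewrite ge0_fin_numE// ltW.
pose r := fine I; have r0 : 0 < r by rewrite fine_gt0// I0.
have Ir : I = r%:E by rewrite fineK.
exists (fun x => (Num.sqrt r)^-1 * chi x); split.
- exact: smoothZ.
- by exists K => // x /K0 ->; rewrite mulr0.
- by move=> x nB; rewrite K0 ?mulr0// => /Kb.
- under eq_integral do rewrite exprMn exprVn sqr_sqrtr ?(ltW r0)// EFinM.
  rewrite ge0_integralZl//.
  + by rewrite -/I Ir -EFinM mulVf// gt_eqF.
  + exact: smooth_measurable_EFin.
  + by move=> x _; rewrite lee_fin sqr_ge0.
  + by rewrite lee_fin invr_ge0 ltW.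
Qed.

Variables (gamma : 'I_m -> 'M[R[i]]_N) (gammaP : clifford gamma).

(** For real g the commutator multiplies the pointwise norm by exactly |grad g|, so the estimate
    loses no constant depending on N. *)
Lemma opnorm_dirac_comm_real (g : 'rV[R]_m -> R) : smooth g ->
  (forall x, \sum_(mu < m) partial mu g x ^+ 2 <= 1) ->
  (opnorm (dirac_comm gamma (fun x => real_complex R (g x))) <= 1)%E.
Proof.
move=> sg g1; apply: ge_ereal_sup => _ [s [[ss _] /L2norm_le1 s1] <-].
apply/L2norm_le1; apply: le_trans s1.
have E x : spinor_sqr (dirac_comm gamma (fun x => real_complex R (g x)) s x) =
    (\sum_(mu < m) partial mu g x ^+ 2) * spinor_sqr (s x).
  rewrite spinor_sqr_dirac_comm//; last exact: csmooth_real.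
  rewrite -(spinor_sqr_slash_real gammaP); congr (spinor_sqr (slash _ _ *m _)).
  by apply/funext => mu; rewrite /cpartial/= partial_cst.
under eq_integral do rewrite E.
have sV : smooth (fun x => \sum_(mu < m) partial mu g x ^+ 2).
  apply: smooth_sum => mu; under eq_fun do rewrite expr2.
  by apply: smoothM; exact: smooth_partial.
have sS := smooth_spinor_sqr ss.
apply: ge0_le_integral => //.
- move=> x _; rewrite lee_fin mulr_ge0 ?spinor_sqr_ge0// sumr_ge0// => mu _.
  exact: sqr_ge0.
- exact: (smooth_measurable_EFin (smoothM sV sS)).
- exact: (smooth_measurable_EFin sS).
- by move=> x _; rewrite lee_fin ler_piMl ?spinor_sqr_ge0.
Qed.

Lemma gradient_le1_of_opnorm (f : 'rV[R]_m -> R[i]) : (0 < N)%N -> csmooth f ->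
  (opnorm (dirac_comm gamma f) <= 1)%E ->
  forall p, \sum_(mu < m) Normc.normc (cpartial mu f p) ^+ 2 <= 1.
Proof.
move=> N0 sf f1 p; rewrite leNgt; apply/negP => V1.
have [j Vj] := spinor_sqr_slash_basis gammaP (fun mu => cpartial mu f p) N0.
pose H x := spinor_sqr (slash gamma (fun mu => cpartial mu f x) *m delta_mx j ord0).
have sH : smooth H.
  apply/smooth_spinor_sqr/csmooth_slash => [mu|a]; last exact: csmooth_cst.
  exact: csmooth_cpartial.
have H1 : 1 < H p by exact: lt_le_trans V1 Vj.
(* The index j is fixed at p; continuity of H keeps it above the midpoint c > 1 on a ball. A
   normalised bump there has an image of squared norm at least c, against the bound 1. *)
pose c := (1 + H p) / 2.
have /nbhs_ballP[e /= e0 ec] : \forall x \near p, c < H x.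
  have cH : continuous H := smooth_continuous sH.
  by apply: (cvgr_gt _ (cH p)); rewrite /c; lra.
have [chi [schi [K cK chiK] chib chi1]] := exists_bump p e0.
pose s x : 'cV[R[i]]_N := real_complex R (chi x) *: delta_mx j ord0.
have ss a : csmooth (fun x => s x a ord0).
  under eq_fun do rewrite mxE; apply: csmoothM; first exact: csmooth_real.
  exact: csmooth_cst.
have sE x (A : 'M[R[i]]_N) :
    spinor_sqr (A *m s x) = chi x ^+ 2 * spinor_sqr (A *m delta_mx j ord0).
  rewrite /s -scalemxAr spinor_sqrZ; congr (_ * _).
  by rewrite sqr_normcE/= expr0n addr0.
have d1 : spinor_sqr (delta_mx j ord0 : 'cV[R[i]]_N) = 1.
  rewrite /spinor_sqr (bigD1 j)//= big1 => [|a aj]; rewrite sqr_normcE mxE ?eqxx/=.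
    by rewrite expr0n expr1n !addr0.
  by rewrite (negbTE aj)/= expr0n addr0.
have ts : test_spinor s.
  by split=> //; exists K => // x /chiK; rewrite /s => ->; rewrite raddf0 scale0r.
have s1 : (L2norm s <= 1)%E.
  apply/L2norm_le1; rewrite -chi1 le_eqVlt; apply/orP; left; apply/eqP.
  by apply: eq_integral => x _; rewrite -[s x]mul1mx sE mul1mx d1 mulr1.
have TE x : spinor_sqr (dirac_comm gamma f s x) = chi x ^+ 2 * H x.
  by rewrite spinor_sqr_dirac_comm// sE.
have : (L2norm (dirac_comm gamma f s) <= 1)%E.
  by apply: le_trans f1; apply: ereal_sup_ubound; exists s.
move=> /L2norm_le1; apply/negP; rewrite -ltNge.
have c1 : 1 < c by rewrite /c; lra.
apply: (@lt_le_trans _ _ c%:E); first by rewrite lte_fin.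
have schi2 : smooth (fun x => chi x ^+ 2).
  by under eq_fun do rewrite expr2; exact: smoothM.
rewrite -[c%:E]mule1 -chi1 -ge0_integralZl//; first last.
- by rewrite lee_fin; lra.
- by move=> x _; rewrite lee_fin sqr_ge0.
- exact: smooth_measurable_EFin.
apply: ge0_le_integral => //.
- by move=> x _; rewrite lee_fin mulr_ge0 ?sqr_ge0//; lra.
- exact: (smooth_measurable_EFin (smoothZ c schi2)).
- under eq_fun do rewrite TE.
  exact: (smooth_measurable_EFin (smoothM schi2 sH)).
- move=> x _; rewrite -EFinM lee_fin TE mulrC.
  have [/ec cH|/chib ->] := pselect (ball p e x); last by rewrite expr0n !mul0r.
  by apply: ler_wpM2l; [exact: sqr_ge0|exact: ltW].
Qed.

End L2_bounds.

(** * Admissible approximations of the distance to z *)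

Section exponential_distance.
Context {R : realType} {m : nat}.
Variables (z : 'rV[R]_m) (k : R) (k_gt0 : 0 < k).

(* The norm is regularised at z to be smooth, and k - k exp(-t/k) replaces t so
   that, up to the constant k, the function vanishes at infinity; only
   differences of values of a function enter the spectral distance. *)
Definition exp_dist (x : 'rV[R]_m) : R :=
  - (k * expR (- (k^-1 * Num.sqrt (k^-1 ^+ 2 + enorm (x - z) ^+ 2)))).

Let q (x : 'rV[R]_m) : R := k^-1 ^+ 2 + \sum_(i < m) (x ord0 i - z ord0 i) ^+ 2.

Let qE x : k^-1 ^+ 2 + enorm (x - z) ^+ 2 = q x.
Proof. by rewrite sqr_enorm /q; under eq_bigr do rewrite !mxE. Qed.

Let q_gt0 x : 0 < q x.
Proof. by rewrite -qE ltr_pwDl ?sqr_ge0// exprn_gt0// invr_gt0. Qed.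

Let smooth_q : smooth q.
Proof. by apply: smoothD; [exact: smooth_cst|exact: smooth_sqr_dist]. Qed.

Let rho x := Num.sqrt (q x).

Let rho_gt0 x : 0 < rho x.
Proof. by rewrite sqrtr_gt0. Qed.

Let smooth_rho : smooth rho.
Proof. exact: smooth_sqrt. Qed.

Let exp_distE x : exp_dist x = - k * expR (- k^-1 * rho x).
Proof. by rewrite /exp_dist qE !mulNr. Qed.

Lemma smooth_exp_dist : smooth exp_dist.
Proof.
rewrite (_ : exp_dist = fun x => - k * expR (- k^-1 * rho x)).
  by apply: smoothZ; apply: smooth_expR; exact: smoothZ.
by apply/funext => x; exact: exp_distE.
Qed.

Let partial_q mu x : partial mu q x = 2 * (x ord0 mu - z ord0 mu).
Proof.
have dc i : differentiable (fun y : 'rV[R]_m => y ord0 i + - z ord0 i) x.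
  by apply: smooth_differentiable; apply: smoothD; [exact: smooth_coord|exact: smooth_cst].
have pc i : partial mu (fun y : 'rV[R]_m => y ord0 i + - z ord0 i) x = (i == mu)%:R.
  rewrite partialD; first by rewrite partial_coord partial_cst addr0.
  - by apply: smooth_differentiable; exact: smooth_coord.
  - exact: differentiable_cst.
rewrite /q partialD; last 2 first.
- exact: differentiable_cst.
- by apply: smooth_differentiable; exact: smooth_sqr_dist.
rewrite partial_cst add0r partial_sum => [|i]; last first.
  under eq_fun do rewrite expr2.
  exact: (differentiableM (dc i) (dc i)).
rewrite (eq_bigr (fun i => 2 * (x ord0 i - z ord0 i) * (i == mu)%:R)).
  rewrite (bigD1 mu)//= eqxx mulr1 big1 ?addr0// => i /negbTE ->.
  by rewrite mulr0.
move=> i _; under [X in partial mu X]eq_fun do rewrite expr2.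
by rewrite partialM// pc; ring.
Qed.

Let partial_exp_dist mu x : partial mu exp_dist x =
  expR (- k^-1 * rho x) * ((x ord0 mu - z ord0 mu) / rho x).
Proof.
rewrite (_ : exp_dist = fun x => - k * expR (- k^-1 * rho x)); last first.
  by apply/funext => y; exact: exp_distE.
have drho : differentiable (fun y => - k^-1 * rho y) x.
  by apply: smooth_differentiable; exact: smoothZ.
rewrite partialZ; last first.
  by apply: smooth_differentiable; apply: smooth_expR; exact: smoothZ.
rewrite (partial_comp _ drho (is_derive_expR _)) partialZ; last first.
  exact: smooth_differentiable.
have dq : differentiable q x by exact: smooth_differentiable.
rewrite (partial_comp _ dq (is_derive1_sqrt (q_gt0 x))) partial_q.
rewrite -/(rho x) invfM.
have k0 : k != 0 by rewrite gt_eqF.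
have r0 : rho x != 0 by rewrite gt_eqF.
by field; apply/andP.
Qed.

(** The squared gradient is exp(-2 rho/k) |x - z|^2 / rho^2, and |x - z| <= rho by the choice of the
    regularisation. *)
Lemma gradient_exp_dist x : \sum_(mu < m) partial mu exp_dist x ^+ 2 <= 1.
Proof.
rewrite (eq_bigr (fun mu => (expR (- k^-1 * rho x) ^+ 2 / q x) *
    (x ord0 mu - z ord0 mu) ^+ 2)); last first.
  move=> mu _; rewrite partial_exp_dist exprMn expr_div_n sqr_sqrtr ?ltW//.
  by rewrite mulrCA mulrC.
rewrite -mulr_sumr mulrAC ler_pdivrMr// mul1r.
rewrite (@le_trans _ _ (\sum_(mu < m) (x ord0 mu - z ord0 mu) ^+ 2))//.
  rewrite ler_piMl//; first by apply: sumr_ge0 => i _; exact: sqr_ge0.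
  rewrite expr_le1 ?expR_ge0// expR_le1 mulNr oppr_le0 mulr_ge0 ?invr_ge0 ?ltW//.
by rewrite /q lerDr sqr_ge0.
Qed.

Lemma exp_dist_lipschitz x y : `|exp_dist x - exp_dist y| <= enorm (x - y).
Proof.
apply: gradient_le1_lipschitz => [u|]; last exact: gradient_exp_dist.
exact: (smooth_differentiable _ smooth_exp_dist).
Qed.

Let expRN_le (t : R) : 0 <= t -> expR (- t) <= (1 + t)^-1.
Proof.
move=> t0; rewrite expRN lef_pV2 ?posrE ?expR_gt0 ?expR_ge1Dx//.
by rewrite ltr_pwDl.
Qed.

Lemma C0_exp_dist (e : R) : 0 < e ->
  exists2 K : set 'rV[R]_m, compact K & forall x, ~ K x -> `|exp_dist x| < e.
Proof.
(* From k exp(-rho/k) <= k / (1 + rho/k) <= k^2 / rho, a value of size at least e forces rho <= k^2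
   / e, and rho dominates each coordinate of x - z. *)
move=> e0; pose M := k ^+ 2 / e.
exists [set x : 'rV[R]_m | forall i, `[z ord0 i - M, z ord0 i + M]%classic (x ord0 i)].
  by apply: (rV_compact (A := fun i => `[z ord0 i - M, z ord0 i + M]%classic)) => i;
    exact: segment_compact.
move=> x; apply: contra_notT; rewrite -leNgt => ex i.
rewrite /= in_itv/= -ler_distl.
have xr : `|x ord0 i - z ord0 i| <= rho x.
  rewrite -sqrtr_sqr ler_wsqrtr// /q (bigD1 i)//= addrCA lerDl addr_ge0 ?sqr_ge0//.
  by apply: sumr_ge0 => j _; exact: sqr_ge0.
apply: (le_trans xr); move: ex; rewrite exp_distE normrM normrN.
rewrite (gtr0_norm k_gt0) (gtr0_norm (expR_gt0 _)) mulNr => ex.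
have t0 : 0 <= k^-1 * rho x by rewrite mulr_ge0 ?invr_ge0 ?ltW.
have {ex} : e <= k * (1 + k^-1 * rho x)^-1.
  by apply: (le_trans ex); rewrite ler_pM2l// expRN_le.
rewrite ler_pdivlMr ?ltr_pwDl// => ex.
rewrite /M ler_pdivlMr//.
have : e * (k^-1 * rho x) <= k.
  by apply: le_trans ex; rewrite mulrDr mulr1 lerDr ltW.
by rewrite mulrCA ler_pdivrMl// -expr2 mulrC.
Qed.

(** The inequality 1 + u <= exp(u), for u = -rho/k and u = rho/k, encloses k - k exp(-rho/k) between
    rho / (1 + rho/k) and rho, while r <= rho <= r + 1/k. Both bounds tend to r: the single
    parameter k drives the cutoff and the smoothing at z together. *)
Lemma exp_dist_bounds x :
  (k + exp_dist x) <= enorm (x - z) + k^-1 /\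
  enorm (x - z) / (1 + k^-1 * (enorm (x - z) + k^-1)) <= k + exp_dist x.
Proof.
have kV : 0 < k^-1 by rewrite invr_gt0.
have k0 : k != 0 by rewrite gt_eqF.
set r := enorm (x - z); have r0 : 0 <= r by exact: enorm_ge0.
have rr : r <= rho x.
  rewrite -[leLHS]ger0_norm// -sqrtr_sqr ler_wsqrtr// -qE lerDr sqr_ge0//.
have rr' : rho x <= r + k^-1.
  rewrite -[leRHS]ger0_norm ?addr_ge0 ?(ltW kV)// -sqrtr_sqr ler_wsqrtr// -qE -/r.
  by rewrite sqrrD addrC lerD2r lerDl mulrn_wge0// mulr_ge0// ltW.
have t0 : 0 <= k^-1 * rho x by rewrite mulr_ge0 ?ltW.
rewrite exp_distE !mulNr; split.
  apply: le_trans rr'; have := expR_ge1Dx (- (k^-1 * rho x)).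
  rewrite -(ler_pM2l k_gt0) mulrDr mulr1 mulrN mulrA divff// mul1r.
  by rewrite lerBlDr lerBlDl addrC.
rewrite (@le_trans _ _ (k - k * (1 + k^-1 * rho x)^-1))//; last first.
  by rewrite lerD2l lerN2 ler_pM2l// expRN_le.
have d0 : 0 < 1 + k^-1 * rho x by rewrite ltr_pwDl.
have -> : k - k * (1 + k^-1 * rho x)^-1 = rho x / (1 + k^-1 * rho x).
  by field; rewrite k0/= -[k + rho x](_ : k * (1 + k^-1 * rho x) = _) ?mulf_neq0 ?gt_eqF//;
    field.
apply: ler_pM => //.
  by rewrite invr_ge0 addr_ge0// mulr_ge0 ?addr_ge0// ltW.
rewrite lef_pV2 ?posrE//; last by rewrite ltr_pwDl// mulr_ge0 ?addr_ge0// ltW.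
by rewrite lerD2l ler_pM2l.
Qed.

End exponential_distance.

(** * Expectation against psi of functions of linear growth *)

Section expectation.
Context {R : realType} {m : nat} (psi : 'rV[R]_m -> R).
Hypothesis psi_L1 : (lebesgue_rV m).-integrable setT (EFin \o psi).
Hypothesis psi_ge0 : {ae lebesgue_rV m, forall xi, 0 <= psi xi}.
Hypothesis psi_int1 : (\int[lebesgue_rV m]_xi (psi xi)%:E = 1)%E.
Hypothesis psi_moment1 :
  (\int[lebesgue_rV m]_xi (enorm xi * psi xi)%:E < +oo)%E.
Implicit Types (g h : 'rV[R]_m -> R) (x y : 'rV[R]_m).

(** A class integrable against [psi] thanks to the first moment, closed under the operations used,
    and containing every Lipschitz function composed with a dilation; it replaces case-by-case
    integrability proofs. *)
Definition linear_growth g : Prop :=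
  measurable_fun setT g /\ exists C D, forall xi, `|g xi| <= C + D * enorm xi.

Lemma linear_growth_cst (c : R) : linear_growth (fun=> c).
Proof. by split=> //; exists `|c|, 0 => xi; rewrite mul0r addr0. Qed.

Lemma linear_growthD g h :
  linear_growth g -> linear_growth h -> linear_growth (fun xi => g xi + h xi).
Proof.
move=> [mg [C [D gCD]]] [mh [C' [D' hCD]]]; split.
  exact: measurable_funD.
exists (C + C'), (D + D') => xi; apply: le_trans (ler_normD _ _) _.
by rewrite mulrDl addrACA lerD.
Qed.

Lemma linear_growthZ (c : R) g :
  linear_growth g -> linear_growth (fun xi => c * g xi).
Proof.
move=> [mg [C [D gCD]]]; split; first exact: measurable_funM.
by exists (`|c| * C), (`|c| * D) => xi; rewrite normrM -mulrA -mulrDr ler_wpM2l.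
Qed.

Lemma linear_growthB g h :
  linear_growth g -> linear_growth h -> linear_growth (fun xi => g xi - h xi).
Proof.
move=> Lg Lh; under eq_fun do rewrite -[- h _]mulN1r.
by apply: linear_growthD => //; exact: linear_growthZ.
Qed.

Lemma linear_growth_lipschitz g x (s : R) :
  (forall u v, `|g u - g v| <= enorm (u - v)) -> measurable_fun setT g ->
  linear_growth (fun xi => g (x + s *: xi)).
Proof.
move=> gL mg; split; first exact: (measurableT_comp mg (measurable_dilation_rV x s)).
exists `|g x|, `|s| => xi; rewrite -enormZ.
rewrite -[g _](subrK (g x)) addrC; apply: le_trans (ler_normD _ _) _.
by rewrite lerD2l; apply: le_trans (gL _ _) _; rewrite addrAC subrr add0r.
Qed.

Lemma linear_growth_enorm x (s : R) :
  linear_growth (fun xi => enorm (x + s *: xi)).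
Proof.
by apply: linear_growth_lipschitz; [exact: ler_dist_enorm|exact: measurable_enorm].
Qed.

Let mpsi : measurable_fun setT psi.
Proof. by apply/measurable_EFinP; exact: measurable_int psi_L1. Qed.

Lemma integrable_moment1 :
  (lebesgue_rV m).-integrable setT (EFin \o (fun xi => enorm xi * psi xi)).
Proof.
have mf : measurable_fun setT (EFin \o (fun xi => enorm xi * psi xi)).
  by apply/measurable_EFinP; apply: measurable_funM => //; exact: measurable_enorm.
apply/integrableP; split=> //.
(* The moment hypothesis bounds the integral without absolute values; the two integrands agree
   almost everywhere because [psi] is nonnegative there. *)
rewrite (@ae_eq_integral _ _ _ _ _ (EFin \o (fun xi => enorm xi * psi xi)))//.
  exact: measurableT_comp.
apply: filterS psi_ge0 => xi p0 _ /=.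
by rewrite ger0_norm// mulr_ge0// enorm_ge0.
Qed.

Lemma integrable_linear_growth g : linear_growth g ->
  (lebesgue_rV m).-integrable setT (EFin \o (fun xi => g xi * psi xi)).
Proof.
move=> [mg [C [D gCD]]].
have iCD : (lebesgue_rV m).-integrable setT
    (EFin \o (fun xi => (C + D * enorm xi) * psi xi)).
  have i1 := integrableZl measurableT C psi_L1.
  have i2 := integrableZl measurableT D integrable_moment1.
  apply: eq_integrable (integrableD measurableT i1 i2) => // xi _ /=.
  by rewrite -!EFinM -EFinD mulrDl mulrA.
apply: le_integrable iCD => //.
  by apply/measurable_EFinP; exact: measurable_funM.
move=> xi _ /=; rewrite lee_fin !normrM ler_wpM2r//.
exact: le_trans (gCD xi) (ler_norm _).
Qed.

Definition expect g : R := \int[lebesgue_rV m]_xi (g xi * psi xi).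

Lemma EFin_expect g : linear_growth g ->
  (\int[lebesgue_rV m]_xi (g xi * psi xi)%:E = (expect g)%:E)%E.
Proof.
by move=> Lg; rewrite fineK//; exact: integrable_fin_num (integrable_linear_growth Lg).
Qed.

Lemma expect_cst (c : R) : expect (fun=> c) = c.
Proof. by rewrite /expect RintegralZl// /Rintegral psi_int1 mulr1. Qed.

Lemma expectD g h : linear_growth g -> linear_growth h ->
  expect (fun xi => g xi + h xi) = expect g + expect h.
Proof.
move=> Lg Lh; rewrite /expect; under eq_Rintegral do rewrite mulrDl.
by rewrite RintegralD//; exact: integrable_linear_growth.
Qed.

Lemma expectZ (c : R) g : linear_growth g ->
  expect (fun xi => c * g xi) = c * expect g.
Proof.
move=> Lg; rewrite /expect; under eq_Rintegral do rewrite -mulrA.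
by rewrite RintegralZl//; exact: integrable_linear_growth.
Qed.

Lemma expectB g h : linear_growth g -> linear_growth h ->
  expect (fun xi => g xi - h xi) = expect g - expect h.
Proof.
move=> Lg Lh; rewrite /expect; under eq_Rintegral do rewrite mulrBl.
by rewrite RintegralB//; exact: integrable_linear_growth.
Qed.

Lemma le_expect g h : linear_growth g -> linear_growth h ->
  (forall xi, g xi <= h xi) -> expect g <= expect h.
Proof.
move=> Lg Lh gh; rewrite -subr_ge0 -expectB// /expect /Rintegral.
have Lhg := linear_growthB Lh Lg.
(* [psi] may be negative on a null set; its absolute value makes the integrand nonnegative
   everywhere. *)
rewrite (@ae_eq_integral _ _ _ _ _ (EFin \o (fun xi => (h xi - g xi) * `|psi xi|)))//.
- rewrite fine_ge0//; apply: integral_ge0 => xi _ /=.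
  by rewrite lee_fin mulr_ge0// subr_ge0.
- exact: measurable_int (integrable_linear_growth Lhg).
- apply/measurable_EFinP; apply: measurable_funM; first by case: Lhg.
  exact: measurableT_comp.
- by apply: filterS psi_ge0 => xi p0 _ /=; rewrite ger0_norm.
Qed.

Lemma dilated_stateE (f : 'rV[R]_m -> R[i]) (sigma : R) x : 0 < sigma ->
  linear_growth (fun xi => complex.Re (f (x + sigma *: xi))) ->
  linear_growth (fun xi => complex.Im (f (x + sigma *: xi))) ->
  measurable_fun setT (fun y => complex.Re (f y)) ->
  measurable_fun setT (fun y => complex.Im (f y)) ->
  dilated_state psi sigma x f =
  Complex (expect (fun xi => complex.Re (f (x + sigma *: xi))))
          (expect (fun xi => complex.Im (f (x + sigma *: xi)))).
Proof.
move=> s0 LRe LIm mRe mIm.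
have part (A : 'rV[R]_m -> R) : measurable_fun setT A ->
    linear_growth (fun xi => A (x + sigma *: xi)) ->
    (sigma ^+ m)^-1 *
      \int[lebesgue_rV m]_xi (A xi * psi (sigma^-1 *: (xi - x))) =
    expect (fun xi => A (x + sigma *: xi)).
  move=> mA LA.
  have K xi : sigma^-1 *: (x + sigma *: xi - x) = xi.
    by rewrite addrAC subrr add0r scalerA mulVf ?gt_eqF// scale1r.
  rewrite (@integral_dilation _ _ x sigma)//.
  - rewrite mulrA mulVf ?mul1r; last by rewrite gt_eqF// exprn_gt0.
    by apply: eq_Rintegral => xi _; rewrite K.
  - apply: measurable_funM => //; apply: measurableT_comp => //.
    rewrite (_ : (fun xi => _) = fun xi => - (sigma^-1 *: x) + sigma^-1 *: xi).
      exact: measurable_dilation_rV.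
    by apply/funext => xi; rewrite scalerBr addrC.
  - under eq_fun do rewrite K.
    exact: integrable_linear_growth LA.
rewrite /dilated_state /cintegral -(part _ mRe LRe) -(part _ mIm LIm).
have re xi : complex.Re (f xi * real_complex R (psi (sigma^-1 *: (xi - x)))) =
    complex.Re (f xi) * psi (sigma^-1 *: (xi - x)).
  by case: (f xi) => a b /=; rewrite mulr0 subr0.
have im xi : complex.Im (f xi * real_complex R (psi (sigma^-1 *: (xi - x)))) =
    complex.Im (f xi) * psi (sigma^-1 *: (xi - x)).
  by case: (f xi) => a b /=; rewrite mulr0 add0r.
under [X in Complex X _]eq_Rintegral do rewrite re.
under [X in Complex _ X]eq_Rintegral do rewrite im.
set I := \int[_]_xi _; set J := \int[_]_xi _.
by apply/eqP; rewrite eq_complex /= !mul0r subr0 addr0 !eqxx.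
Qed.

End expectation.

(** * Spectral distance and transport cost: both inequalities *)

Section duality.
Context {R : realType} {m N : nat}.
Variables (gamma : 'I_m -> 'M[R[i]]_N) (gammaP : clifford gamma).
Variable psi : 'rV[R]_m -> R.
Hypothesis psi_L1 : (lebesgue_rV m).-integrable setT (EFin \o psi).
Hypothesis psi_ge0 : {ae lebesgue_rV m, forall xi, 0 <= psi xi}.
Hypothesis psi_int1 : (\int[lebesgue_rV m]_xi (psi xi)%:E = 1)%E.
Hypothesis psi_moment1 :
  (\int[lebesgue_rV m]_xi (enorm xi * psi xi)%:E < +oo)%E.
Implicit Types (f : 'rV[R]_m -> R[i]) (x y : 'rV[R]_m) (sigma : R).

Local Notation expect := (expect psi).

Definition dirac_lipschitz f : Prop :=
  C0_smooth f /\ (opnorm (dirac_comm gamma f) <= 1)%E.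

(** The mean displacement when the two dilated densities are coupled through a common xi. *)
Definition cost x y sigma sigma' : R :=
  expect (fun xi => enorm (x - y + (sigma - sigma') *: xi)).

Lemma lipschitz_combination f (a b : R) : (0 < N)%N -> csmooth f ->
  (opnorm (dirac_comm gamma f) <= 1)%E -> a ^+ 2 + b ^+ 2 <= 1 ->
  forall u v, `|(a * complex.Re (f u) + b * complex.Im (f u)) -
                (a * complex.Re (f v) + b * complex.Im (f v))| <= enorm (u - v).
Proof.
move=> N0 sf f1 ab1.
have [sA sB] := sf.
apply: (@gradient_le1_lipschitz _ _
    (fun u => a * complex.Re (f u) + b * complex.Im (f u))) => u.
  by apply: smooth_differentiable; apply: smoothD; exact: smoothZ.
apply: le_trans (gradient_le1_of_opnorm gammaP N0 sf f1 u).
apply: ler_sum => mu _.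
rewrite partialD; do ?[by apply: smooth_differentiable; exact: smoothZ].
rewrite !partialZ; do ?[exact: smooth_differentiable].
rewrite sqr_normcE /cpartial/=.
set p := partial mu _ u; set q := partial mu _ u.
have pq0 : 0 <= p ^+ 2 + q ^+ 2 by rewrite addr_ge0 ?sqr_ge0.
apply: (@le_trans _ _ ((a ^+ 2 + b ^+ 2) * (p ^+ 2 + q ^+ 2))); last first.
  by rewrite ler_piMl.
(* Lagrange's identity: (a^2 + b^2)(p^2 + q^2) - (a p + b q)^2 = (a q - b p)^2. *)
rewrite -subr_ge0 [leRHS](_ : _ = (a * q - b * p) ^+ 2) ?sqr_ge0//; ring.
Qed.

Lemma Re_lipschitz f u v : (0 < N)%N -> csmooth f ->
  (opnorm (dirac_comm gamma f) <= 1)%E ->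
  `|complex.Re (f u) - complex.Re (f v)| <= enorm (u - v).
Proof.
move=> N0 sf f1; have := @lipschitz_combination f 1 0 N0 sf f1 _ u v.
by rewrite expr1n expr0n/= addr0 lexx !mul1r !mul0r !addr0 => /(_ isT).
Qed.

Lemma Im_lipschitz f u v : (0 < N)%N -> csmooth f ->
  (opnorm (dirac_comm gamma f) <= 1)%E ->
  `|complex.Im (f u) - complex.Im (f v)| <= enorm (u - v).
Proof.
move=> N0 sf f1; have := @lipschitz_combination f 0 1 N0 sf f1 _ u v.
by rewrite expr1n expr0n/= add0r lexx !mul1r !mul0r !add0r => /(_ isT).
Qed.

Lemma dilated_state_smoothE f sigma x : (0 < N)%N -> csmooth f ->
  (opnorm (dirac_comm gamma f) <= 1)%E -> 0 < sigma ->
  dilated_state psi sigma x f =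
  Complex (expect (fun xi => complex.Re (f (x + sigma *: xi))))
          (expect (fun xi => complex.Im (f (x + sigma *: xi)))).
Proof.
move=> N0 sf f1 s0; have [sA sB] := sf.
have LA u v := @Re_lipschitz f u v N0 sf f1.
have LB u v := @Im_lipschitz f u v N0 sf f1.
have mA := smooth_measurable_fun sA; have mB := smooth_measurable_fun sB.
apply: dilated_stateE => //.
- exact: (linear_growth_lipschitz (g := fun u => complex.Re (f u))).
- exact: (linear_growth_lipschitz (g := fun u => complex.Im (f u))).
Qed.

Lemma dist_dilated_state_le f x y sigma sigma' : (0 < N)%N ->
  dirac_lipschitz f -> 0 < sigma -> 0 < sigma' ->
  Normc.normc (dilated_state psi sigma x f - dilated_state psi sigma' y f) <=
  cost x y sigma sigma'.
Proof.
move=> N0 [[sf _] f1] s0 s0'; have [sA sB] := sf.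
rewrite !dilated_state_smoothE//.
have mA := smooth_measurable_fun sA; have mB := smooth_measurable_fun sB.
have LA u v := @Re_lipschitz f u v N0 sf f1.
have LB u v := @Im_lipschitz f u v N0 sf f1.
have gA z s := linear_growth_lipschitz (g := fun u => complex.Re (f u)) z s LA mA.
have gB z s := linear_growth_lipschitz (g := fun u => complex.Im (f u)) z s LB mB.
pose dA := expect (fun xi => complex.Re (f (x + sigma *: xi))) -
  expect (fun xi => complex.Re (f (y + sigma' *: xi))).
pose dB := expect (fun xi => complex.Im (f (x + sigma *: xi))) -
  expect (fun xi => complex.Im (f (y + sigma' *: xi))).
rewrite -[X in Normc.normc X]/(Complex dA dB).
have Lc := linear_growth_enorm (x - y) (sigma - sigma').
set r := Normc.normc _.
have r2 : r ^+ 2 = dA ^+ 2 + dB ^+ 2 by rewrite sqr_normcE.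
have r0 : 0 <= r by exact: sqrtr_ge0.
have [r00|rn0] := eqVneq r 0.
  rewrite r00 -(expect_cst psi_L1 psi_int1 0).
  apply: le_expect => //; first exact: linear_growth_cst.
  by move=> xi; exact: enorm_ge0.
(* (a, b) is the direction of the complex number dA + i dB, so that its modulus r = a dA + b dB is
   the expectation of a difference of values of one real Lipschitz function. *)
pose a := dA / r; pose b := dB / r.
have ab1 : a ^+ 2 + b ^+ 2 = 1.
  by rewrite /a /b !expr_div_n -mulrDl -r2 divff// sqrf_eq0.
have Lab := lipschitz_combination N0 sf f1 (eq_ind_r (fun t => t <= 1) (lexx 1) ab1).
pose g u := a * complex.Re (f u) + b * complex.Im (f u).
have Lg z s : linear_growth (fun xi => g (z + s *: xi)).
  by apply: linear_growthD; exact: linear_growthZ.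
have -> : r = expect (fun xi => g (x + sigma *: xi) - g (y + sigma' *: xi)).
  rewrite expectB// /g !expectD//; do ?[exact: linear_growthZ].
  rewrite !expectZ//.
  rewrite [RHS](_ : _ = a * dA + b * dB); last by rewrite /dA /dB; ring.
  rewrite /a /b ![_ / r * _]mulrAC -!expr2 -mulrDl -r2 expr2 mulfK//.
apply: le_expect => //; first exact: linear_growthB.
move=> xi; apply: le_trans (ler_norm _) _; apply: le_trans (Lab _ _) _.
by rewrite opprD addrACA scalerBl.
Qed.

Lemma exp_dist_cvg (z : 'rV[R]_m) u :
  (n.+1%:R + exp_dist z n.+1%:R u @[n --> \oo] --> enorm (u - z)).
Proof.
set r := enorm _.
have h0 : (n.+1%:R : R)^-1 @[n --> \oo] --> (0 : R) by exact: cvg_harmonic.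
apply: (@squeeze_cvgr _ _ _ _
    (fun n => r / (1 + n.+1%:R^-1 * (r + n.+1%:R^-1)))
    (fun n => r + n.+1%:R^-1)).
- near=> n; have n0 : 0 < n.+1%:R :> R by [].
  by have [-> ->] := exp_dist_bounds z n0 u.
- rewrite -[X in _ --> X]mulr1 -[X in _ * X]invr1; apply: cvgM; first exact: cvg_cst.
  apply: cvgV; first exact: oner_neq0.
  rewrite -[X in _ --> X](addr0) -[X in _ + X](mul0r (r + 0)).
  by apply: cvgD; [exact: cvg_cst|apply: cvgM => //; apply: cvgD => //; exact: cvg_cst].
- by rewrite -[X in _ --> X]addr0; apply: cvgD => //; exact: cvg_cst.
Unshelve. all: by end_near. Qed.

Lemma dirac_lipschitz_exp_dist (z : 'rV[R]_m) (k : R) : 0 < k ->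
  dirac_lipschitz (fun u => real_complex R (exp_dist z k u)).
Proof.
move=> k0; have sE := smooth_exp_dist z k0; split; last first.
  by apply: opnorm_dirac_comm_real => //; exact: gradient_exp_dist.
split; first exact: csmooth_real.
move=> e e0; have [K cK KE] := C0_exp_dist z k0 e0; exists K => // u /KE.
by rewrite /= expr0n/= addr0 sqrtr_sqr.
Qed.

(* The two dilations x + sigma xi and y + sigma' xi agree at one point xi0, and
   the distance to their common value z is the optimal potential. *)
Lemma cost_le_of_lt x y sigma sigma' (M : R) : (0 < N)%N ->
  0 < sigma' -> sigma' < sigma ->
  (forall f, dirac_lipschitz f ->
    Normc.normc (dilated_state psi sigma x f - dilated_state psi sigma' y f) <= M) ->
  cost x y sigma sigma' <= M.
Proof.
move=> N0 s0' s's fM; have s0 : 0 < sigma by exact: lt_trans s's.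
have d0 : 0 < sigma - sigma' by rewrite subr_gt0.
have dn0 : sigma - sigma' != 0 by rewrite gt_eqF.
pose xi0 := - ((sigma - sigma')^-1 *: (x - y)); pose z := x + sigma *: xi0.
have zE : z = y + sigma' *: xi0.
  apply/eqP; rewrite -subr_eq0 /z opprD addrACA -scalerBl /xi0 scalerN scalerA.
  by rewrite divff// scale1r subrr.
(* The two vectors to z are sigma (xi - xi0) and sigma' (xi - xi0): they are parallel, so the
   difference of their lengths is the length of their difference, with the right sign because sigma
   > sigma'. *)
have distE xi : enorm (x + sigma *: xi - z) - enorm (y + sigma' *: xi - z) =
    enorm (x - y + (sigma - sigma') *: xi).
  rewrite {1}/z zE opprD addrACA subrr add0r -scalerBr.
  rewrite (opprD y) addrACA subrr add0r -scalerBr.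
  rewrite !enormZ (gtr0_norm s0) (gtr0_norm s0') -mulrBl -[X in X * _](gtr0_norm d0).
  rewrite -enormZ scalerBr /xi0 scalerN opprK scalerA divff// scale1r.
  by rewrite addrC.
pose E n u := exp_dist z n.+1%:R u.
have E0 n : (0 : R) < n.+1%:R by [].
have mE n : measurable_fun setT (E n)
  by apply: smooth_measurable_fun; exact: smooth_exp_dist.
have LE n u v : `|E n u - E n v| <= enorm (u - v) by exact: exp_dist_lipschitz.
have gE n w s : linear_growth (fun xi => E n (w + s *: xi)).
  exact: linear_growth_lipschitz.
pose D n xi := E n (x + sigma *: xi) - E n (y + sigma' *: xi).
have gD n : linear_growth (D n) by exact: linear_growthB.
have DM n : expect (D n) <= M.
  apply: le_trans (fM _ (dirac_lipschitz_exp_dist z (E0 n))).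
  have [[sf _] f1] := dirac_lipschitz_exp_dist z (E0 n).
  rewrite !dilated_state_smoothE//= /D expectB//.
  by rewrite -[leLHS]/(_ - _) (le_trans (ler_norm _))// -sqrtr_sqr ler_wsqrtr// lerDl sqr_ge0.
have Lc := linear_growth_enorm (x - y) (sigma - sigma').
have DL n xi : `|D n xi| <= enorm (x - y + (sigma - sigma') *: xi).
  by apply: le_trans (LE _ _ _) _; rewrite opprD addrACA scalerBl.
have mI g : linear_growth g -> measurable_fun setT (fun xi => (g xi * psi xi)%:E).
  by move=> Lg; have := measurable_int _ (integrable_linear_growth psi_L1 psi_ge0 psi_moment1 Lg).
(* The bound [DL] from the Lipschitz property does not depend on n, so the integrand of the cost
   itself dominates. *)
have [] := @dominated_convergence _ _ R (lebesgue_rV m) setT measurableT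
  (fun n xi => (D n xi * psi xi)%:E)
  (fun xi => (enorm (x - y + (sigma - sigma') *: xi) * psi xi)%:E)
  (fun xi => `|(enorm (x - y + (sigma - sigma') *: xi) * psi xi)%:E|%E).
- by move=> n; exact: mI.
- exact: mI.
- apply: aeW => xi _; apply: cvg_EFin; first by near=> n.
  apply: cvgM; last exact: cvg_cst.
  rewrite -distE.
  (* The constants n + 1 that make each term converge cancel in [D n]. *)
  have CC := cvgB (@exp_dist_cvg z (x + sigma *: xi)) (@exp_dist_cvg z (y + sigma' *: xi)).
  rewrite (_ : D^~ xi = fun n => n.+1%:R + exp_dist z n.+1%:R (x + sigma *: xi) -
    (n.+1%:R + exp_dist z n.+1%:R (y + sigma' *: xi))); first exact: CC.
  have K (a b c : R) : a - b = c + a - (c + b) by ring.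
  by apply/funext => n; exact: K.
- by apply: integrable_abse; exact: integrable_linear_growth.
- by apply: aeW => xi n _ /=; rewrite lee_fin !normrM ler_wpM2r// (le_trans (DL n xi))// ler_norm.
move=> _ _ cI; rewrite -lee_fin /cost -EFin_expect//.
rewrite -(cvg_lim _ cI)//; apply: lime_le.
  by apply/cvg_ex; eexists; exact: cI.
by near=> n; rewrite /= EFin_expect// lee_fin.
Unshelve. all: by end_near. Qed.

Lemma costC x y sigma sigma' : cost x y sigma sigma' = cost y x sigma' sigma.
Proof.
congr expect; apply/funext => xi; rewrite -enormN opprD opprB -scaleNr opprB.
by [].
Qed.

Lemma normc_distC (z w : R[i]) : Normc.normc (z - w) = Normc.normc (w - z).
Proof. by rewrite -normcN opprB. Qed.

Lemma cost_le_of_neq x y sigma sigma' (M : R) : (0 < N)%N ->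
  0 < sigma -> 0 < sigma' -> sigma != sigma' ->
  (forall f, dirac_lipschitz f ->
    Normc.normc (dilated_state psi sigma x f - dilated_state psi sigma' y f) <= M) ->
  cost x y sigma sigma' <= M.
Proof.
move=> N0 s0 s0'; rewrite neq_lt => /orP[ss'|s's] fM; last exact: cost_le_of_lt.
rewrite costC; apply: (cost_le_of_lt N0 s0 ss') => f Lf.
by rewrite normc_distC; exact: fM.
Qed.

(** With equal scales the two dilations differ by the constant x - y and share no value unless x =
    y. The second scale is therefore moved from sigma to tau = sigma + d. *)
Lemma cost_le x y sigma sigma' (M : R) : (0 < N)%N ->
  0 < sigma -> 0 < sigma' ->
  (forall f, dirac_lipschitz f ->
    Normc.normc (dilated_state psi sigma x f - dilated_state psi sigma' y f) <= M) ->
  cost x y sigma sigma' <= M.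
Proof.
move=> N0 s0 s0' fM.
have [eqs|] := eqVneq sigma sigma'; last by move=> neqs; exact: cost_le_of_neq.
rewrite -{}eqs in s0' fM *.
have Len : linear_growth (@enorm R m).
  have := linear_growth_enorm (0 : 'rV[R]_m) 1.
  by under eq_fun do rewrite add0r scale1r.
pose c := expect (@enorm R m).
have c0 : 0 <= c.
  rewrite -(expect_cst psi_L1 psi_int1 0).
  apply: le_expect => //; first exact: linear_growth_cst.
  by move=> xi; exact: enorm_ge0.
have costss : cost x y sigma sigma = enorm (x - y).
  rewrite -[RHS](expect_cst psi_L1 psi_int1).
  by congr expect; apply/funext => xi; rewrite subrr scale0r addr0.
rewrite costss; apply/ler_addgt0Pr => e e0.
(* Moving the scale costs d c twice, once in the transport cost and once in the distance between
   states. The summand 1 keeps the denominator positive even if c = 0. *)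
pose d := e / (2 * c + 1); have c1 : 0 < 2 * c + 1 by rewrite ltr_wpDl// mulr_ge0.
have d0 : 0 < d by rewrite divr_gt0.
pose tau := sigma + d; have t0 : 0 < tau by rewrite addr_gt0.
have st : sigma - tau = - d by rewrite /tau opprD addrA subrr add0r.
have costyy : cost y y sigma tau = d * c.
  rewrite /cost -expectZ//; congr expect; apply/funext => xi.
  by rewrite subrr add0r enormZ st normrN gtr0_norm.
have costxy : enorm (x - y) - d * c <= cost x y sigma tau.
  rewrite -[X in X - _](expect_cst psi_L1 psi_int1).
  rewrite -expectZ// -expectB//; [|exact: linear_growth_cst|exact: linear_growthZ].
  apply: le_expect => //.
  - by apply: linear_growthB; [exact: linear_growth_cst|exact: linear_growthZ].
  - exact: linear_growth_enorm.
  - move=> xi; rewrite lerBlDr st -[X in X * enorm xi](gtr0_norm d0) -enormZ.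
    rewrite -[X in enorm X <= _](addrK (- d *: xi)).
    by apply: le_trans (ler_enormD _ _) _; rewrite enormN scaleNr enormN.
have : cost x y sigma tau <= M + d * c.
  apply: cost_le_of_neq => //; first by rewrite lt_eqF// ltrDl.
  (* Triangle inequality through the state at y with scale sigma; the upper bound already proved,
     with both centres at y, controls the second leg by d c. *)
  move=> f Lf; rewrite -(subrK (dilated_state psi sigma y f) (dilated_state psi sigma x f)) -addrA.
  apply: le_trans (le_normcD _ _) _; apply: lerD; first exact: fM.
  by rewrite -costyy; exact: dist_dilated_state_le.
have eE : d * c + d * c + d = e.
  by rewrite -[X in _ + X]mulr1 -!mulrDr -mulr2n -mulr_natl /d divfK ?gt_eqF.
move=> cM; rewrite lerBlDr in costxy.
apply: le_trans costxy _; apply: le_trans (lerD cM (lexx _)) _.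
by rewrite -eE !addrA lerDl ltW.
Qed.

Lemma spectral_dist_dilated_state x y sigma sigma' : (0 < N)%N ->
  0 < sigma -> 0 < sigma' ->
  spectral_dist gamma (dilated_state psi sigma x) (dilated_state psi sigma' y) =
  (cost x y sigma sigma')%:E.
Proof.
move=> N0 s0 s0'; apply/eqP; rewrite eq_le; apply/andP; split.
  apply: ge_ereal_sup => _ [f Lf <-]; rewrite lee_fin.
  exact: dist_dilated_state_le.
set S := spectral_dist _ _ _.
have fS f : dirac_lipschitz f ->
    ((Normc.normc (dilated_state psi sigma x f - dilated_state psi sigma' y f))%:E <= S)%E.
  by move=> Lf; apply: ereal_sup_ubound; exists f.
(* One admissible function shows that the supremum is not -oo. *)
have := fS _ (dirac_lipschitz_exp_dist 0 ltr01).
case: S fS => [M| |] fS.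
- by move=> _; rewrite lee_fin; apply: cost_le => // f /fS; rewrite lee_fin.
- by move=> _; rewrite leey.
- by rewrite leeNy_eq.
Qed.

End duality.

Theorem proposition3p2 (R : realType) (m N : nat) (m_gt0 : (0 < m)%N)
  (N_gt0 : (0 < N)%N) (gamma : 'I_m -> 'M[R[i]]_N) (gammaP : clifford gamma)
  (psi : 'rV[R]_m -> R)
  (psi_L1 : (lebesgue_rV m).-integrable setT (EFin \o psi))
  (psi_ge0 : {ae lebesgue_rV m, forall xi, 0 <= psi xi})
  (psi_int1 : (\int[lebesgue_rV m]_xi (psi xi)%:E = 1)%E)
  (psi_moment1 : (\int[lebesgue_rV m]_xi (enorm xi * psi xi)%:E < +oo)%E) :
  (forall (x y : 'rV[R]_m) (sigma sigma' : R), 0 < sigma -> 0 < sigma' ->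
     spectral_dist gamma (dilated_state psi sigma x)
                         (dilated_state psi sigma' y) =
     (\int[lebesgue_rV m]_xi
        (enorm (x - y + (sigma - sigma') *: xi) * psi xi)%:E)%E) /\
  (forall (x y : 'rV[R]_m) (sigma : R), 0 < sigma ->
     spectral_dist gamma (dilated_state psi sigma x)
                         (dilated_state psi sigma y) =
     (enorm (x - y))%:E).
Proof.
have growth (x y : 'rV[R]_m) (s s' : R) :
    linear_growth (fun xi => enorm (x - y + (s - s') *: xi)).
  exact: linear_growth_enorm.
split=> [x y sigma sigma' s0 s0'|x y sigma s0].
  rewrite (spectral_dist_dilated_state gammaP psi_L1 psi_ge0 psi_int1 psi_moment1)//.
  by rewrite (EFin_expect psi_L1 psi_ge0 psi_moment1 (growth x y sigma sigma')).
rewrite (spectral_dist_dilated_state gammaP psi_L1 psi_ge0 psi_int1 psi_moment1)//.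
(* With equal scales the displacement is the constant x - y, and [psi] has mass 1. *)
rewrite -[in RHS](expect_cst psi_L1 psi_int1 (enorm (x - y))).
congr (_%:E); congr (expect psi); apply/funext => xi.
by rewrite subrr scale0r addr0.
Qed.
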